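(* There exists an absolute constant $C>0$ such that the following holds. Let $n,d\ge 1$ be natural numbers, let $x_1,\dots,x_n$ be arbitrary points in $\mathbb{R}^d$, let $\varepsilon\in(0,\frac12)$, and let $k$ be a natural number with $1\le k\le d$ and $k\ge C\varepsilon^{-2}\log^3 n$. Let $a=(a_0,\dots,a_{d-1})$ be either independent Bernoulli variables or independent standard normal variables, let $\varkappa=(\varkappa_0,\dots,\varkappa_{d-1})$ be independent Bernoulli variables, independent of $a$, and put $$f(x)=\frac{1}{\sqrt k}\,M_{a,k}D_{\varkappa}x,\qquad x\in\mathbb{R}^d .$$ Then with probability at least $2/3$ (with respect to $a$ and $\varkappa$) the following holds: $$(1-\varepsilon)\|x_i-x_j\|_2^2\le \|f(x_i)-f(x_j)\|_2^2\le (1+\varepsilon)\|x_i-x_j\|_2^2\qquad\text{for all } i,j=1,\dots,n.$$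
   Context: $\|\cdot\|_2$ denotes the Euclidean norm in $\mathbb{R}^d$ or $\mathbb{R}^k$. A Bernoulli variable is a random variable taking the values $+1$ and $-1$ with probability $1/2$ each. For $k\le d$ and $a=(a_0,\dots,a_{d-1})$, $M_{a,k}$ is the $k\times d$ partial circulant matrix $$M_{a,k}=\begin{pmatrix} a_0 & a_1 & a_2 & \dots & a_{d-1}\\ a_{d-1} & a_0 & a_1 & \dots & a_{d-2}\\ a_{d-2} & a_{d-1} & a_0 & \dots & a_{d-3}\\ \vdots & \vdots & \vdots & \ddots & \vdots\\ a_{d-k+1} & a_{d-k+2} & a_{d-k+3} & \dots & a_{d-k}\end{pmatrix},$$ i.e. with rows indexed by $j=0,\dots,k-1$ and columns by $i=0,\dots,d-1$, its $(j,i)$ entry is $a_{(i-j)\bmod d}$. $D_{\varkappa}$ is the $d\times d$ diagonal matrix with diagonal entries $\varkappa_0,\dots,\varkappa_{d-1}$. *)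

(* Defs.v *)
From HB Require Import structures.
From mathcomp Require Import all_boot all_order all_algebra.
From mathcomp Require Import all_classical all_reals all_analysis.

Set Implicit Arguments.
Unset Strict Implicit.
Unset Printing Implicit Defensive.

Import Order.TTheory GRing.Theory Num.Theory.
Local Open Scope classical_set_scope.
Local Open Scope ring_scope.

(* The library norm on matrices is the sup norm. *)
Definition enorm (R : realType) (m : nat) (v : 'cV[R]_m) : R :=
  Num.sqrt (\sum_(i < m) v i ord0 ^+ 2).

Definition sub_mod (d : nat) (i : 'I_d) (j : nat) : 'I_d :=
  Ordinal (ltn_pmod (i + (d - j)) (leq_ltn_trans (leq0n i) (ltn_ord i))).

(* The truncated subtraction in [sub_mod] computes (i - j) mod d only for
   j <= d, so this is the partial circulant matrix only when k <= d. *)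
Definition partial_circulant (R : realType) (k d : nat) (a : 'I_d -> R) :
    'M[R]_(k, d) :=
  \matrix_(j < k, i < d) a (sub_mod i j).

Definition circulant_map (R : realType) (k d : nat) (a kappa : 'I_d -> R)
    (x : 'cV[R]_d) : 'cV[R]_k :=
  (Num.sqrt k%:R)^-1 *:
    (partial_circulant k a *m diag_mx (\row_(i < d) kappa i) *m x).

Section RandomVariables.
Context {disp : measure_display} {T : measurableType disp} {R : realType}.
Variable P : probability T R.

(* Values +1 and -1; the library's [bernoulli_prob] is the law on booleans. *)
Definition sign_bernoulli (X : {RV P >-> R}) : Prop :=
  P (X @^-1` [set 1]) = (2^-1)%:E /\ P (X @^-1` [set -1]) = (2^-1)%:E.

(* Both sides are set functions on all subsets, hence the restriction to
   measurable sets. *)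
Definition standard_normal (X : {RV P >-> R}) : Prop :=
  forall B : set R, measurable B -> distribution P X B = normal_prob 0 1 B.

Definition mutually_independent (I : finType) (X : I -> {RV P >-> R}) : Prop :=
  forall (J : {set I}) (B : I -> set R),
    (forall i, i \in J -> measurable (B i)) ->
    P (\big[setI/setT]_(i in J) (X i @^-1` B i)) =
    (\prod_(i in J) P (X i @^-1` B i))%E.

Definition generated_sigma (I : Type) (X : I -> {RV P >-> R}) : set (set T) :=
  <<s \bigcup_(i in [set: I]) preimage_set_system setT (X i) measurable >>.

Definition independent_families (I J : Type)
    (X : I -> {RV P >-> R}) (Y : J -> {RV P >-> R}) : Prop :=
  forall A B : set T, generated_sigma X A -> generated_sigma Y B ->
    P (A `&` B) = (P A * P B)%E.

End RandomVariables.

(* Main.v *)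
Require Import Defs.
From mathcomp Require Import all_boot all_order all_algebra.
From mathcomp Require Import all_classical all_reals all_analysis.
From mathcomp Require Import measurable_realfun zify ring lra.

Set Implicit Arguments.
Unset Strict Implicit.
Unset Printing Implicit Defensive.

Import Order.TTheory GRing.Theory Num.Theory.
Local Open Scope classical_set_scope.
Local Open Scope ring_scope.

(* For y = x_i - x_j, the random variable k |f(y)|^2 - k |y|^2 splits into a
   part D depending on a only and a quadratic chaos O in the signs kappa, whose
   coefficients are y_i y_j G_ij with G_ij the autocorrelations of a. For q of
   order log n the 2q-th moments are bounded as follows. Given a, the chaos is
   decoupled by a random bipartition of the indices and two applications of
   Khinchine's inequality give E O^2q <= (C q^2 sum y_i^2 y_j^2 G_ij^2)^q.
   The autocorrelation G_ij is a sum of k products of pairs of coordinates;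
   after another random bipartition the pairs are disjoint, hence independent,
   and a Bernstein-type moment bound gives E G_ij^2q <= (C q k)^q as soon as
   q <= k; D is handled in the same way. Altogether
   E (D + O)^2q <= (C q^3 k |y|^4)^q, and Markov's inequality with a union bound
   over the pairs (i, j) concludes. Gaussian and Bernoulli coordinates are
   treated together through the only properties used: mean 0, variance 1 and
   E X^2l <= 2 4^l l!. *)

(** * Exponential and power-mean inequalities *)

(** The power log^3 n is the q^3 of the moment bound: q^2 from the two uses of Khinchine, q from the
    Bernstein-type bound. For k a large multiple of q^3 / eps^2, Markov at order 2q leaves a failure
    probability 16^-q for each of D and O, compared separately with half of the tolerance; q >= ln n
    + 2 makes this small against the n^2 pairs. The same lower bound on k yields the side condition
    q <= k. The obstacle is dependence: a coordinate of a may occur in two of the products that make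
    up G_ij, and the signs enter quadratically. Random bipartitions remove both, and by convexity
    each costs only a factor 16^q. The signs are handled as points of a finite cube, where
    expectations are finite sums; the law of kappa enters only at the end, through a splitting along
    the 2^d sign patterns. *)

Section Exponential.
Variable R : realType.
Implicit Types x y : R.

Lemma expr_le_fact_expR x n : 0 <= x -> x ^+ n <= n`!%:R * expR x.
Proof.
move=> x0; case: n => [|n].
  by rewrite expr0 fact0 mul1r -[leLHS]addr0 (le_trans _ (expR_ge1Dx x)) ?lerD2l.
rewrite mulrC -ler_pdivrMr ?ltr0n ?fact_gt0//.
by apply: le_trans (expR_ge1Dxn n x0); rewrite lerDr.
Qed.

(** The exponent is not optimal, which allows an elementary proof. Take x >= 0 by symmetry. If 2x^2
    <= 1, the bounds e^x <= 1/(1-x) and e^-x <= 1/(1+x) add up to 2/(1-x^2), and (1-x^2)(1+2x^2) >=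
    1. Otherwise x <= 2x^2 suffices. *)
Lemma cosh_le_expR_sqr x : expR x + expR (- x) <= 2 * expR (2 * x ^+ 2).
Proof.
wlog x0 : x / 0 <= x.
  move=> H; case: (leP 0 x) => [|/ltW x0]; first exact: H.
  by have := H (- x); rewrite opprK sqrrN addrC; apply; rewrite oppr_ge0.
have [x2|x2] := leP (2 * x ^+ 2) 1; last first.
  have xx : x <= 2 * x ^+ 2 by nra.
  have : expR (- x) <= expR x by rewrite ler_expR; lra.
  have : expR x <= expR (2 * x ^+ 2) by rewrite ler_expR.
  lra.
have x1 : x < 1 by nra.
have up : expR x <= (1 - x)^-1.
  rewrite -[expR x]invrK -expRN lef_pV2 ?posrE ?expR_gt0 ?subr_gt0//.
  exact: expR_ge1Dx.
have dn : expR (- x) <= (1 + x)^-1.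
  rewrite expRN lef_pV2 ?posrE ?expR_gt0 ?expR_ge1Dx//; lra.
have -> : 2 * expR (2 * x ^+ 2) = 2 * (expR (- (2 * x ^+ 2)))^-1.
  by rewrite expRN invrK.
apply: (@le_trans _ _ (2 * (1 - x ^+ 2)^-1)).
  have -> : 2 * (1 - x ^+ 2)^-1 = (1 - x)^-1 + (1 + x)^-1.
    by field; apply/and3P; split; apply/eqP; nra.
  exact: lerD.
rewrite ler_pM2l// lef_pV2 ?posrE ?expR_gt0//; last by nra.
rewrite expRN -div1r ler_pdivrMr ?expR_gt0//.
have := expR_ge1Dx (2 * x ^+ 2); set e := expR _ => he.
apply: le_trans (ler_wpM2l _ he); nra.
Qed.

Lemma expR_half_le2 : expR 2^-1 <= 2 :> R.
Proof.
rewrite -[expR _]invrK -expRN -[leRHS]invrK lef_pV2 ?posrE ?expR_gt0 ?invr_gt0//.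
by apply: le_trans (expR_ge1Dx _); lra.
Qed.

Lemma expR1_le4 : expR 1 <= 4 :> R.
Proof.
have -> : expR 1 = expR 2^-1 * expR 2^-1 :> R by rewrite -expRD; congr expR; lra.
have -> : 4 = 2 * 2 :> R by lra.
by rewrite ler_pM ?expR_ge0 ?expR_half_le2.
Qed.

Lemma factn_le_expn n : (n`! <= n ^ n)%N.
Proof.
elim: n => // -[//|n] IH; rewrite factS expnS leq_mul2l /=.
by rewrite (leq_trans IH)// leq_exp2r.
Qed.

End Exponential.

Section PowerMean.
Variable R : realDomainType.

(** Chebyshev's sum inequality: twice the difference of the two sides is the double sum of w_i w_j
    (f_i - f_j)(g_i - g_j). *)
Lemma chebyshev_sum (I : finType) (w f g : I -> R) :
  (forall i, 0 <= w i) -> (forall i j, 0 <= (f i - f j) * (g i - g j)) ->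
  (\sum_i w i * f i) * (\sum_i w i * g i)
    <= (\sum_i w i) * (\sum_i w i * (f i * g i)).
Proof.
move=> w0 fg; rewrite !big_distrlr /=.
rewrite -subr_ge0 -(pmulrn_lge0 _ (isT : (0 < 2)%N)) mulr2n.
rewrite -sumrB; under eq_bigr do rewrite -sumrB.
rewrite [X in _ + X]exchange_big -big_split /=.
apply: sumr_ge0 => i _; rewrite -big_split /=; apply: sumr_ge0 => j _.
suff -> : w i * (w j * (f j * g j)) - w i * f i * (w j * g j)
   + (w j * (w i * (f i * g i)) - w j * f j * (w i * g i))
   = (w i * w j) * ((f i - f j) * (g i - g j)) by apply: mulr_ge0; [apply: mulr_ge0|].
ring.
Qed.

(** Jensen's inequality for powers, by induction with [chebyshev_sum] applied to t and t^(n+1),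
    which are similarly ordered. Since the weights are not normalized, no division by a possibly
    vanishing total weight occurs. *)
Lemma power_mean (I : finType) (w t : I -> R) n :
  (forall i, 0 <= w i) -> (forall i, 0 <= t i) ->
  (\sum_i w i * t i) ^+ n.+1 <= (\sum_i w i) ^+ n * \sum_i w i * t i ^+ n.+1.
Proof.
move=> w0 t0; have W0 : 0 <= \sum_i w i by exact: sumr_ge0.
have wt0 m : 0 <= \sum_i w i * t i ^+ m.
  by apply: sumr_ge0 => i _; rewrite mulr_ge0// exprn_ge0.
elim: n => [|n IH]; first by rewrite expr0 mul1r expr1.
rewrite exprS; apply: le_trans (ler_wpM2l (wt0 1%N) IH) _.
rewrite mulrCA exprS -mulrA [leRHS]mulrCA ler_wpM2l ?exprn_ge0//.
have -> : \sum_i w i * t i ^+ n.+2 = \sum_i w i * (t i * t i ^+ n.+1).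
  by apply: eq_bigr => i _; rewrite exprS.
apply: chebyshev_sum => // i j.
wlog tij : i j / t j <= t i.
  move=> H; case: (leP (t j) (t i)) => [|/ltW tji]; first exact: H.
  by have := H _ _ tji; rewrite -(opprB (t i)) -(opprB (t i ^+ _)) mulrNN.
by rewrite mulr_ge0 ?subr_ge0// lerXn2r ?nnegrE.
Qed.

Lemma power_mean_even (I : finType) (w t : I -> R) q :
  (forall i, 0 <= w i) -> (0 < q)%N ->
  (\sum_i w i * t i) ^+ (2 * q)
    <= (\sum_i w i) ^+ (2 * q).-1 * \sum_i w i * t i ^+ (2 * q).
Proof.
move=> w0 q0; have e2 : (2 * q = (2 * q).-1.+1)%N by rewrite prednK// muln_gt0.
have ev x : `|x| ^+ (2 * q) = x ^+ (2 * q) :> R.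
  by rewrite -normrX ger0_norm// exprn_even_ge0// mul2n odd_double.
rewrite -ev; apply: (@le_trans _ _ ((\sum_i w i * `|t i|) ^+ (2 * q))).
  apply: lerXn2r; rewrite ?nnegrE//.
    by apply: sumr_ge0 => i _; rewrite mulr_ge0.
  apply: le_trans (ler_norm_sum _ _ _) _; apply: ler_sum => i _.
  by rewrite normrM (ger0_norm (w0 i)).
have := @power_mean I w (fun i => `|t i|) (2 * q).-1 w0 (fun i => normr_ge0 _).
rewrite -e2 /= => /le_trans; apply.
by apply: ler_wpM2l; [rewrite exprn_ge0 ?sumr_ge0|apply: ler_sum => i _; rewrite ev].
Qed.

End PowerMean.

(** * Averages over the discrete cube *)

(** A point of the cube is read in two ways: as a choice of signs through [rsign], and as a random
    subset of [I] in the decoupling. [sign_mixture] links these finite averages to the random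
    signs. *)
Definition cube_mean (R : realType) (I : finType) (F : {ffun I -> bool} -> R) : R :=
  (2 ^+ #|I|)^-1 * \sum_s F s.

Definition rsign {R : realType} (b : bool) : R := (-1) ^+ b.

Section Cube.
Variables (R : realType) (I : finType).
Implicit Types (F G : {ffun I -> bool} -> R) (c : I -> R).
Local Notation E := (@cube_mean R I).
Local Notation e := (@rsign R).

Lemma eq_cube_mean F G : F =1 G -> E F = E G.
Proof. by move=> FG; congr (_ * _); apply: eq_bigr. Qed.

Lemma le_cube_mean F G : (forall s, F s <= G s) -> E F <= E G.
Proof.
by move=> FG; rewrite ler_wpM2l ?invr_ge0 ?exprn_ge0//; exact: ler_sum.
Qed.

Lemma cube_meanZ a F : E (fun s => a * F s) = a * E F.
Proof. by rewrite /cube_mean -mulr_sumr mulrCA. Qed.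

Lemma cube_meanZr a F : E (fun s => F s * a) = E F * a.
Proof. by rewrite mulrC -cube_meanZ; apply: eq_cube_mean => s; rewrite mulrC. Qed.

Lemma cube_meanD F G : E (fun s => F s + G s) = E F + E G.
Proof. by rewrite /cube_mean big_split mulrDr. Qed.

Lemma cube_mean_sum (J : finType) (Q : pred J) (F : J -> {ffun I -> bool} -> R) :
  E (fun s => \sum_(j | Q j) F j s) = \sum_(j | Q j) E (F j).
Proof. by rewrite /cube_mean exchange_big mulr_sumr. Qed.

Lemma card_cube : #|{ffun I -> bool}|%:R = 2 ^+ #|I| :> R.
Proof. by rewrite card_ffun card_bool natrX. Qed.

Lemma cube_mean_cst a : E (fun=> a) = a.
Proof.
rewrite /cube_mean sumr_const -[a *+ _]mulr_natl -card_cube.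
by rewrite mulKf// card_cube expf_neq0.
Qed.

Lemma exchange_cube_mean (F : {ffun I -> bool} -> {ffun I -> bool} -> R) :
  E (fun s => E (F s)) = E (fun t => E (F^~ t)).
Proof. by rewrite /cube_mean -!mulr_sumr exchange_big. Qed.

Lemma cube_mean_prod (f : I -> bool -> R) :
  E (fun s => \prod_i f i (s i)) = \prod_i (2^-1 * (f i true + f i false)).
Proof.
rewrite big_split /= prodr_const exprVn; congr (_ * _).
under [RHS]eq_bigr do rewrite -big_bool.
by rewrite bigA_distr_bigA.
Qed.

Lemma cube_mean_power_mean F q : (0 < q)%N -> E F ^+ (2 * q) <= E (fun s => F s ^+ (2 * q)).
Proof.
move=> q0; have u0 : 0 <= (2 ^+ #|I|)^-1 :> R by rewrite invr_ge0 exprn_ge0.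
rewrite /cube_mean !mulr_sumr.
apply: le_trans (power_mean_even _ _ q0) _ => [//|].
suff -> : \sum_(s : {ffun I -> bool}) (2 ^+ #|I|)^-1 = 1 :> R by rewrite expr1n mul1r.
by rewrite -[RHS](cube_mean_cst 1) /cube_mean mulr_sumr; under [RHS]eq_bigr do rewrite mulr1.
Qed.

Lemma rsign_sqr b : e b ^+ 2 = 1.
Proof. by rewrite /rsign -exprM mulnC mul2n -signr_odd odd_double. Qed.

Lemma rsign_addb a b : e (a (+) b) = e a * e b.
Proof. by rewrite /rsign signr_addb. Qed.

Lemma expr_le_fact_expRD (x : R) n :
  x ^+ n <= n`!%:R * (expR x + expR (- x)).
Proof.
apply: le_trans (ler_norm _) _; rewrite normrX.
apply: le_trans (expr_le_fact_expR _ (normr_ge0 x)) _.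
rewrite ler_wpM2l//; case: (ger0P x) => _.
  by rewrite lerDl expR_ge0.
by rewrite lerDr expR_ge0.
Qed.

(** The moment is read off the exponential moment with parameter [l], which factorizes over the
    coordinates and is at most e^(2 l^2 V). The choice l^2 = q/V turns this into e^(2q) <=
    4^(2q). *)
Lemma khinchine c q : (0 < q)%N ->
  E (fun s => (\sum_i c i * e (s i)) ^+ (2 * q))
    <= (128 * q%:R * \sum_i c i ^+ 2) ^+ q.
Proof.
move=> q0; set V := \sum_i c i ^+ 2.
have V0 : 0 <= V by apply: sumr_ge0 => i _; exact: sqr_ge0.
have qR0 : 0 < q%:R :> R by rewrite ltr0n.
have [V00|Vn0] := eqVneq V 0.
  have c0 i : c i = 0.
    apply/eqP; rewrite -sqrf_eq0; move/eqP: V00.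
    by rewrite psumr_eq0 => [/allP/(_ i)|j _]; [apply; rewrite mem_index_enum|exact: sqr_ge0].
  rewrite V00 mulr0 expr0n gtn_eqF// (eq_cube_mean (G := fun=> 0)) ?cube_mean_cst// => s.
  by rewrite big1 ?expr0n ?muln_eq0 ?(gtn_eqF q0)//= => i _; rewrite c0 mul0r.
have Vp : 0 < V by rewrite lt_def Vn0.
pose l := Num.sqrt (q%:R / V).
have l0 : 0 < l by rewrite sqrtr_gt0 divr_gt0.
have l2 : l ^+ 2 = q%:R / V by rewrite sqr_sqrtr// divr_ge0.
have mgf (u : R) : u ^+ 2 = l ^+ 2 ->
    E (fun s => expR (u * \sum_i c i * e (s i))) <= 4 ^+ (2 * q).
  move=> ul.
  under eq_cube_mean => s do rewrite mulr_sumr expR_sum.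
  rewrite (cube_mean_prod (fun i b => expR (u * (c i * e b)))).
  apply: (@le_trans _ _ (\prod_i expR (2 * (l ^+ 2 * c i ^+ 2)))).
    apply: ler_prod => i _; rewrite mulr_ge0 ?addr_ge0 ?expR_ge0//=.
    rewrite ler_pdivrMl// /rsign expr1 expr0 mulr1 mulrN1 mulrN addrC -ul -exprMn.
    exact: cosh_le_expR_sqr.
  rewrite -expR_sum -!mulr_sumr -/V l2 divfK// -natrM.
  by rewrite -[X in expR X]mulr1 expRM_natl lerXn2r ?nnegrE ?expR_ge0// expR1_le4.
have : E (fun s => (l * \sum_i c i * e (s i)) ^+ (2 * q))
    <= (2 * q)`!%:R * (4 ^+ (2 * q) + 4 ^+ (2 * q)).
  apply: le_trans (le_cube_mean (fun s => expr_le_fact_expRD _ _)) _.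
  rewrite cube_meanZ cube_meanD ler_wpM2l// lerD//; first exact: mgf.
  under eq_cube_mean do rewrite -mulNr.
  by apply: mgf; rewrite sqrrN.
under eq_cube_mean do rewrite exprMn.
rewrite cube_meanZ -ler_pdivlMl ?exprn_gt0// => /le_trans; apply.
rewrite !exprM l2 -exprVn invf_div.
have -> : 128 * q%:R * V = (V / q%:R) * (128 * q%:R ^+ 2) by field; rewrite gt_eqF.
rewrite [leRHS]exprMn ler_wpM2l ?exprn_ge0 ?divr_ge0//.
(* The first factor absorbs (2q)! <= (2q)^(2q); the second absorbs 4^(2q), counted twice for the two
   signs of the exponent. *)
have -> : 128 * q%:R ^+ 2 = (2 * q%:R) ^+ 2 * (2 * 4 ^+ 2) :> R by ring.
rewrite [leRHS]exprMn; apply: ler_pM => //.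
  rewrite -exprM -natrM -natrX ler_nat; exact: factn_le_expn.
rewrite -mulr2n -[leLHS]mulr_natl [leRHS]exprMn ler_wpM2r ?exprn_ge0//.
by rewrite -[leLHS]expr1 ler_weXn2l// ler1n.
Qed.

End Cube.

Section Decoupling.
Variables (R : realType) (I : finType).
Local Notation E := (@cube_mean R I).
Local Notation e := (@rsign R).

Lemma cube_mean_separate (i j : I) : i != j ->
  E (fun v => (v i && ~~ v j)%:R) = 4^-1.
Proof.
move=> ij.
pose f l (b : bool) : R := if l == i then b%:R else if l == j then (~~ b)%:R else 1.
rewrite (@eq_cube_mean _ _ _ (fun v => \prod_l f l (v l))) => [|v].
  rewrite cube_mean_prod (bigD1 i)//= (bigD1 j) 1?eq_sym//= big1 => [|l /andP[li lj]].
    rewrite /f eqxx [j == i]eq_sym (negPf ij) eqxx /=; lra.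
  rewrite /f (negPf li) (negPf lj); lra.
rewrite (bigD1 i)//= (bigD1 j) 1?eq_sym//= big1 => [|l /andP[li lj]].
  by rewrite /f eqxx [j == i]eq_sym (negPf ij) eqxx /= mulr1 -natrM mulnb.
by rewrite /f (negPf li) (negPf lj).
Qed.

(* A pair of distinct indices is separated, in this order, by a uniformly
   random subset with probability 1/4. *)
Lemma decouple (J : finType) (p r : J -> I) (t : J -> R) :
  \sum_(j | p j != r j) t j =
  4 * E (fun v => \sum_(j | v (p j) && ~~ v (r j)) t j).
Proof.
rewrite (@eq_cube_mean _ _ _ (fun v =>
    \sum_(j | p j != r j) (v (p j) && ~~ v (r j))%:R * t j)).
  rewrite cube_mean_sum mulr_sumr; apply: eq_bigr => j pr.
  by rewrite cube_meanZr cube_mean_separate// mulrA divff// mul1r.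
move=> v; rewrite [LHS]big_mkcond [RHS]big_mkcond; apply: eq_bigr => j _.
have [->|_] := eqVneq (p j) (r j); first by rewrite andbN.
by case: (_ && _); rewrite ?mul1r ?mul0r.
Qed.

Lemma decouple_power (J : finType) (p r : J -> I) (t : J -> R) q : (0 < q)%N ->
  (\sum_(j | p j != r j) t j) ^+ (2 * q) <=
  16 ^+ q * E (fun v => (\sum_(j | v (p j) && ~~ v (r j)) t j) ^+ (2 * q)).
Proof.
move=> q0; rewrite decouple exprMn exprM.
have -> : 4 ^+ 2 = 16 :> R by lra.
by rewrite ler_wpM2l ?exprn_ge0//; exact: cube_mean_power_mean.
Qed.

(** Multiplying the signs outside [v] by those of [t] is an involution of the cube. Once [t] is
    averaged as well, the signs inside and outside [v] form two independent families. *)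
Lemma cube_mean_twist (v t : {ffun I -> bool}) (F : {ffun I -> bool} -> R) :
  E F = E (fun s => F [ffun i => if v i then s i else s i (+) t i]).
Proof.
rewrite /cube_mean; congr (_ * _).
pose h (s : {ffun I -> bool}) := [ffun i => if v i then s i else s i (+) t i].
have hK : involutive h.
  by move=> s; apply/ffunP => i; rewrite !ffunE; case: (v i) => //; rewrite addbK.
by rewrite (reindex_inj (inv_inj hK)).
Qed.

(** Khinchine is applied first to the signs outside [v] with those inside frozen, which leaves the
    q-th power of a sum of squares of the linear forms [Y s j], and then to each of these forms. *)
Lemma decoupled_chaos (v : {ffun I -> bool}) (c : I -> I -> R) q : (0 < q)%N ->
  (forall i j, ~~ (v i && ~~ v j) -> c i j = 0) ->
  E (fun s => (\sum_i \sum_j c i j * (e (s i) * e (s j))) ^+ (2 * q))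
    <= ((128 * q%:R) ^+ 2 * \sum_i \sum_j c i j ^+ 2) ^+ q.
Proof.
move=> q0 c0; set K : R := 128 * q%:R.
have K0 : 0 <= K by rewrite mulr_ge0.
pose Y (s : {ffun I -> bool}) j := \sum_i c i j * e (s i).
pose b j := \sum_i c i j ^+ 2.
have b0 j : 0 <= b j by apply: sumr_ge0 => i _; exact: sqr_ge0.
have Y0 s j : b j = 0 -> Y s j = 0.
  move=> bj; apply: big1 => i _; suff -> : c i j = 0 by rewrite mul0r.
  apply/eqP; rewrite -sqrf_eq0; move/eqP: bj.
  by rewrite psumr_eq0 => [/allP/(_ i)|l _]; [apply; rewrite mem_index_enum|exact: sqr_ge0].
have step1 : E (fun s => (\sum_i \sum_j c i j * (e (s i) * e (s j))) ^+ (2 * q))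
    <= E (fun s => (K * \sum_j Y s j ^+ 2) ^+ q).
  (* The average over [t] enters as the average of a constant; after the twist the chaos is linear
     in the signs of [t]. *)
  rewrite -[leLHS](@cube_mean_cst R I); under eq_cube_mean => t do rewrite (cube_mean_twist v t).
  rewrite exchange_cube_mean; apply: le_cube_mean => s.
  rewrite (_ : E _ = E (fun t => (\sum_j (Y s j * e (s j)) * e (t j)) ^+ (2 * q))).
    apply: le_trans (khinchine _ q0) _.
    under eq_bigr do rewrite exprMn rsign_sqr mulr1.
    exact: lexx.
  apply: eq_cube_mean => t; congr (_ ^+ _); rewrite exchange_big; apply: eq_bigr => j _.
  rewrite /Y !mulr_suml; apply: eq_bigr => i _; rewrite !ffunE.
  have [/andP[-> /negbTE ->]|/c0->] := boolP (v i && ~~ v j); last by rewrite !mul0r.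
  by rewrite rsign_addb !mulrA.
apply: le_trans step1 _.
under eq_cube_mean do rewrite exprMn.
rewrite cube_meanZ [leRHS]exprMn [K ^+ 2 ^+ q]exprAC [_ ^+ 2]expr2.
rewrite -mulrA ler_wpM2l ?exprn_ge0//.
have -> : \sum_i \sum_j c i j ^+ 2 = \sum_j b j by rewrite exchange_big.
set B := \sum_j b j.
have B0 : 0 <= B by exact: sumr_ge0.
(* Convexity with weights [b j], the natural size of [Y s j ^+ 2]: by Khinchine the q-th moment of
   the quotient is at most K^q for every j. *)
apply: (@le_trans _ _ (B ^+ q.-1 * \sum_j E (fun s => b j * (Y s j ^+ 2 / b j) ^+ q))).
  rewrite -cube_mean_sum -cube_meanZ; apply: le_cube_mean => s.
  rewrite (eq_bigr (fun j => b j * (Y s j ^+ 2 / b j))); last first.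
    move=> j _; have [bj|bj] := eqVneq (b j) 0; last by rewrite mulrCA divff ?mulr1.
    by rewrite Y0// bj mul0r expr0n.
  have := @power_mean _ _ b (fun j => Y s j ^+ 2 / b j) q.-1 b0.
  rewrite prednK//; apply => j; by rewrite divr_ge0// sqr_ge0.
have -> : K ^+ q * B ^+ q = B ^+ q.-1 * \sum_j (b j * K ^+ q).
  by rewrite -mulr_suml -/B mulrA -exprSr prednK// mulrC.
rewrite ler_wpM2l ?exprn_ge0//; apply: ler_sum => j _.
rewrite cube_meanZ; have [->|bj] := eqVneq (b j) 0; first by rewrite !mul0r.
rewrite ler_wpM2l//.
under eq_cube_mean do rewrite expr_div_n -exprM.
rewrite cube_meanZr ler_pdivrMr ?exprn_gt0 ?lt_def ?bj//= -exprMn.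
exact: khinchine.
Qed.

Lemma chaos (b : I -> I -> R) q : (0 < q)%N ->
  E (fun s => (\sum_(x : I * I | x.1 != x.2) b x.1 x.2 * (e (s x.1) * e (s x.2))) ^+ (2 * q))
    <= (16 * (128 * q%:R) ^+ 2 * \sum_(x : I * I | x.1 != x.2) b x.1 x.2 ^+ 2) ^+ q.
Proof.
move=> q0.
apply: le_trans (le_cube_mean (fun s => decouple_power _ _ _ q0)) _.
rewrite cube_meanZ -(mulrA 16) [leRHS]exprMn ler_wpM2l ?exprn_ge0// exchange_cube_mean.
rewrite -[leRHS](@cube_mean_cst R I); apply: le_cube_mean => v.
pose c i j := if v i && ~~ v j then b i j else 0.
have c0 i j : ~~ (v i && ~~ v j) -> c i j = 0 by rewrite /c => /negbTE ->.
have := decoupled_chaos q0 c0.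
have -> : (fun s : {ffun I -> bool} => 
      (\sum_i \sum_j c i j * (e (s i) * e (s j))) ^+ (2 * q)) =
    (fun s => (\sum_(x : I * I | v x.1 && ~~ v x.2)
      b x.1 x.2 * (e (s x.1) * e (s x.2))) ^+ (2 * q)).
  apply/funext => s; congr (_ ^+ _); rewrite pair_bigA /= [RHS]big_mkcond.
  by apply: eq_bigr => x _; rewrite /c; case: ifP => // _; rewrite mul0r.
(* Pairs that [v] does not separate have coefficient 0 in [c], so the sum of squares only decreases,
   uniformly in [v]. *)
move=> /le_trans; apply; apply: lerXn2r; rewrite ?nnegrE ?mulr_ge0 ?sqr_ge0//.
- by apply: sumr_ge0 => i _; apply: sumr_ge0 => j _; exact: sqr_ge0.
- by apply: sumr_ge0 => i _; exact: sqr_ge0.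
apply: ler_wpM2l; first exact: sqr_ge0.
rewrite pair_bigA [leRHS]big_mkcond; apply: ler_sum => -[i j] _ /=.
have [->|_] := eqVneq i j; rewrite /c ?andbN ?expr0n//.
by case: ifP => // _; rewrite expr0n sqr_ge0.
Qed.

End Decoupling.

(** * Independence and moments *)

Section Independence.
Context {disp : measure_display} {T : measurableType disp} {R : realType}.
Variable P : probability T R.
Variables (I : finType) (X : I -> {RV P >-> R}).
Hypothesis indX : mutually_independent X.

(** For [J = setT] these generate [generated_sigma X]; smaller [J] give the sigma-algebra of a block
    of coordinates. *)
Definition cylinder_generators (J : set I) : set (set T) :=
  \bigcup_(i in J) preimage_set_system setT (X i) measurable.

Lemma measurable_generators J : cylinder_generators J `<=` measurable.
Proof.
by move=> A [i _ [B mB <-]]; apply: measurable_funP.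
Qed.

Lemma measurable_generated J A : <<s cylinder_generators J >> A -> measurable A.
Proof.
apply: smallest_sub; last exact: measurable_generators.
exact: sigma_algebra_measurable.
Qed.

Let boxes (J : set I) : set (set T) :=
  [set A | exists2 B : I -> set R,
     (forall i, measurable (B i)) /\ (forall i, ~ J i -> B i = setT) &
     A = \big[setI/setT]_i (X i @^-1` B i)].

(** Uniqueness of finite measures on a pi-system: as functions of A, both sides are measures, and
    they agree on [boxes J]. A box leaves coordinate i unconstrained, so its intersection with the
    event X_i in B is again a product event, to which mutual independence applies. *)
Lemma independent_rest (J : set I) i A B : ~ J i ->
  <<s cylinder_generators J >> A -> measurable B ->
  P (A `&` X i @^-1` B) = (P A * P (X i @^-1` B))%E.
Proof.
move=> Ji sA mB.
have mXB : measurable (X i @^-1` B) by rewrite -[_ @^-1` _]setTI; exact: measurable_funP.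
have PB0 : P (X i @^-1` B) \is a fin_num by exact: fin_num_measure.
have boxE C : (forall i, measurable (C i)) ->
    P (\big[setI/setT]_i (X i @^-1` C i)) = (\prod_i P (X i @^-1` C i))%E.
  move=> mC; have := @indX [set: I]%SET C (fun i _ => mC i).
  have allI : (fun l : I => l \in [set: I]%SET) =1 xpredT by move=> l; rewrite inE.
  by rewrite (eq_bigl _ _ allI) (eq_bigl _ _ allI).
have boxI : setI_closed (boxes J).
  move=> _ _ [B1 [mB1 J1] ->] [B2 [mB2 J2] ->].
  exists (fun l => B1 l `&` B2 l).
    by split=> [l|l Jl]; [exact: measurableI|rewrite J1// J2// setIid].
  by rewrite -big_split.
have subJ : <<s cylinder_generators J >> `<=` <<s boxes J >>.
  apply: sub_sigma_algebra2 => _ [l Jl [C mC <-]].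
  exists (fun m => if m == l then C else setT).
    split=> m /=; first by case: ifP.
    by case: eqP => [->|].
  rewrite (bigD1 l)//= eqxx big1 ?setTI ?setIT// => m /negbTE ->.
  exact: preimage_setT.
pose Q := mscale (NngNum (fine_ge0 (measure_ge0 P (X i @^-1` B)))) P.
have QE D : Q D = (P D * P (X i @^-1` B))%E by rewrite /Q /mscale /= fineK// muleC.
rewrite -QE; suff : mrestr P mXB A = Q A by [].
apply: (@g_sigma_algebra_measure_unique _ _ _ (boxes J) _ (fun=> setT)) => //.
- move=> _ [C [mC _] ->]; apply: bigsetI_measurable => l _.
  by rewrite -[_ @^-1` _]setTI; exact: measurable_funP.
- move=> _; exists (fun=> setT); first by split.
  by rewrite big1 // => l _; rewrite preimage_setT.
- by rewrite bigcup_const //; exists 0%N.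
- move=> _ [C [mC CJ] ->]; apply: etrans (esym (QE _)).
  rewrite [LHS](_ : _ = P (\big[setI/setT]_l (X l @^-1` C l) `&` X i @^-1` B))//.
  have -> : \big[setI/setT]_l (X l @^-1` C l) `&` X i @^-1` B =
     \big[setI/setT]_l (X l @^-1` (if l == i then B else C l)).
    rewrite (bigD1 i)//= [RHS](bigD1 i)//= eqxx CJ// preimage_setT setTI setIC.
    by congr (_ `&` _); apply: eq_bigr => l /negbTE ->.
  rewrite !boxE// => [|l]; last by case: ifP.
  rewrite (bigD1 i)//= eqxx [in RHS](bigD1 i)//= CJ// preimage_setT probability_setT mul1e muleC.
  by congr (_ * _)%E; apply: eq_bigr => l /negbTE ->.
- move=> _; rewrite [X in (X < _)%E](_ : _ = P (setT `&` X i @^-1` B))//.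
  by rewrite setTI -ge0_fin_numE.
- exact: subJ.
Qed.

End Independence.

Section Moments.
Context {disp : measure_display} {T : measurableType disp} {R : realType}.
Variable P : probability T R.
Implicit Types f g : T -> R.

(** Factorization on rectangles identifies the joint law of U and W with the product of their laws.
    Fubini then applies, integrability over the product being checked by Tonelli. *)
Let Rintegral_independent_RV (U W : {RV P >-> R}) :
  P.-integrable setT (EFin \o U) -> P.-integrable setT (EFin \o W) ->
  P.-integrable setT (EFin \o (fun w => U w * W w)) ->
  (forall A B, measurable A -> measurable B ->
     P (U @^-1` A `&` W @^-1` B) = (P (U @^-1` A) * P (W @^-1` B))%E) ->
  \int[P]_w (U w * W w) = (\int[P]_w U w) * (\int[P]_w W w).
Proof.
move=> iU iW iUW ind.
pose h w := (U w, W w).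
have mh : measurable_fun setT h by exact: measurable_fun_pair.
pose hm : {mfun T >-> (R * R)%type} :=
  MeasurableFun.Pack (MeasurableFun.Class (isMeasurableFun.Build _ _ _ _ _ mh)).
have pmE A : measurable A ->
    (distribution P U \x distribution P W)%E A = distribution P hm A.
  apply: product_measure_unique => {}A B mA mB.
  by rewrite /distribution /pushforward /= -ind.
pose f (z : R * R) : \bar R := (z.1 * z.2)%:E.
have mf : measurable_fun [set: R * R] f.
  by apply/measurable_EFinP; apply: measurable_funM.
have distE (V : {RV P >-> R}) : P.-integrable setT (EFin \o V) ->
    (\int[distribution P V]_x x%:E = (\int[P]_w V w)%:E)%E.
  move=> iV; rewrite integral_distribution//.
  by rewrite fineK// integrable_fin_num.
have idistr (V : {RV P >-> R}) : P.-integrable setT (EFin \o V) ->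
    (distribution P V).-integrable setT (EFin : R -> \bar R).
  move=> iV; exact: integrable_pushforward.
have dist_norm (V : {RV P >-> R}) : P.-integrable setT (EFin \o V) ->
    exists c : R, (\int[distribution P V]_x `|x%:E| = c%:E)%E.
  move=> /idistr iV; exists (fine (\int[distribution P V]_x `|x%:E|)%E).
  rewrite fineK// ge0_fin_numE ?integral_ge0//.
  by case/integrableP: iV.
have [cW cWE] := dist_norm W iW; have [cU cUE] := dist_norm U iU.
have if_ : (distribution P U \x distribution P W)%E.-integrable setT f.
  apply/integrable12ltyP => //.
  have inner (x : R) :
      (\int[distribution P W]_y `|f (x, y)| = cW%:E * `|x%:E|)%E.
    transitivity (\int[distribution P W]_(y in [set: R]) (`|x%:E| * `|y%:E|))%E.
      by apply: eq_integral => y _; rewrite -abseM.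
    rewrite ge0_integralZl//; last exact: measurableT_comp.
    by rewrite cWE muleC.
  under eq_integral do rewrite inner.
  rewrite ge0_integralZl//; last 2 first.
    exact: measurableT_comp.
    by rewrite -cWE integral_ge0.
  by rewrite cUE -EFinM ltry.
apply: EFin_inj; rewrite EFinM.
transitivity (\int[distribution P hm]_z f z)%E.
  by rewrite integral_distribution// fineK// integrable_fin_num.
rewrite -(@eq_measure_integral _ _ _ _ _ (distribution P U \x distribution P W)%E); last first.
  by move=> A mA _; exact: pmE.
rewrite -integral12_prod_meas1// /fubini_F.
have inner (x : R) :
    (\int[distribution P W]_y f (x, y) = (\int[P]_w W w)%:E * x%:E)%E.
  transitivity (\int[distribution P W]_(y in [set: R]) (x%:E * y%:E))%E.
    by apply: eq_integral.
  rewrite integralZl//; last exact: idistr.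
  by rewrite distE// muleC.
under eq_integral do rewrite inner.
by rewrite integralZl// ?distE// 1?muleC//; exact: idistr.
Qed.

Lemma Rintegral_independent f g :
  P.-integrable setT (EFin \o f) -> P.-integrable setT (EFin \o g) ->
  P.-integrable setT (EFin \o (fun w => f w * g w)) ->
  (forall A B, measurable A -> measurable B ->
     P (f @^-1` A `&` g @^-1` B) = (P (f @^-1` A) * P (g @^-1` B))%E) ->
  \int[P]_w (f w * g w) = (\int[P]_w f w) * (\int[P]_w g w).
Proof.
move=> i_f i_g.
have /measurable_EFinP m_f := measurable_int P i_f.
have /measurable_EFinP m_g := measurable_int P i_g.
pose U : {mfun T >-> R} :=
  MeasurableFun.Pack (MeasurableFun.Class (isMeasurableFun.Build _ _ _ _ _ m_f)).
pose W : {mfun T >-> R} :=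
  MeasurableFun.Pack (MeasurableFun.Class (isMeasurableFun.Build _ _ _ _ _ m_g)).
exact: (@Rintegral_independent_RV U W).
Qed.

(** This class is closed under sums and products, so the integrability of any polynomial in the
    coordinates follows from its shape alone. *)
Definition has_moments f :=
  measurable_fun setT f /\
  forall m, P.-integrable setT (EFin \o (fun w => f w ^+ m)).

Lemma has_moments_measurable f : has_moments f -> measurable_fun setT f.
Proof. by case. Qed.

Lemma has_moments_integrable f : has_moments f -> P.-integrable setT (EFin \o f).
Proof. by case=> _ /(_ 1%N). Qed.

Lemma dominated_integrable f g : measurable_fun setT f ->
  P.-integrable setT (EFin \o g) -> (forall w, `|f w| <= g w) ->
  P.-integrable setT (EFin \o f).
Proof.
move=> m_f i_g fg; apply: le_integrable i_g => //; first exact/measurable_EFinP.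
by move=> w _ /=; rewrite lee_fin (le_trans (fg w))// ler_norm.
Qed.

Lemma integrableD_fun f g : P.-integrable setT (EFin \o f) ->
  P.-integrable setT (EFin \o g) -> P.-integrable setT (EFin \o (fun w => f w + g w)).
Proof. by move=> i_f i_g; exact: (integrableD measurableT i_f i_g). Qed.

Lemma integrableZ_fun a f : P.-integrable setT (EFin \o f) ->
  P.-integrable setT (EFin \o (fun w => a * f w)).
Proof. by move=> i_f; exact: (integrableZl measurableT a i_f). Qed.

Lemma integrable_sum_fun (J : finType) (Q : pred J) (F : J -> T -> R) :
  (forall j, Q j -> P.-integrable setT (EFin \o F j)) ->
  P.-integrable setT (EFin \o (fun w => \sum_(j | Q j) F j w)).
Proof.
move=> iF; have := @integrable_sum _ _ _ P setT measurableT _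
  (index_enum J) Q (fun j => EFin \o F j) iF.
by apply: eq_integrable => // w _ /=; rewrite sumEFin.
Qed.

Lemma has_moments_cst a : has_moments (fun=> a).
Proof.
split=> // m; exact: (finite_measure_integrable_cst P (a ^+ m)).
Qed.

Lemma has_momentsX f n : has_moments f -> has_moments (fun w => f w ^+ n).
Proof.
case=> mf i_f; split=> [|m]; first exact: measurable_funX.
by have := i_f (n * m)%N; under eq_fun do rewrite /comp exprM.
Qed.

Lemma has_momentsM f g : has_moments f -> has_moments g ->
  has_moments (fun w => f w * g w).
Proof.
move=> [mf i_f] [mg i_g]; split=> [|m]; first exact: measurable_funM.
apply: (@dominated_integrable _ (fun w => f w ^+ (2 * m) + g w ^+ (2 * m))).
- by apply: measurable_funX; exact: measurable_funM.
- exact: integrableD_fun.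
- move=> w; rewrite exprMn normrM ![(2 * m)%N]mulnC !exprM.
  rewrite -(real_normK (num_real (f w ^+ m))) -(real_normK (num_real (g w ^+ m))).
  have := normr_ge0 (f w ^+ m); have := normr_ge0 (g w ^+ m); nra.
Qed.

Lemma has_momentsD f g : has_moments f -> has_moments g ->
  has_moments (fun w => f w + g w).
Proof.
move=> Mf Mg; have mfg : measurable_fun setT (fun w => f w + g w).
  by apply: measurable_funD; [case: Mf|case: Mg].
split=> // m.
under eq_fun do rewrite /comp exprDn.
apply: integrable_sum_fun => i _.
under eq_fun do rewrite /comp -mulr_natl.
apply: integrableZ_fun; apply: has_moments_integrable.
by apply: has_momentsM; exact: has_momentsX.
Qed.

Lemma has_momentsZ a f : has_moments f -> has_moments (fun w => a * f w).
Proof. by apply: has_momentsM; exact: has_moments_cst. Qed.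

Lemma has_moments_sum (J : Type) (r : seq J) (Q : pred J) (F : J -> T -> R) :
  (forall j, Q j -> has_moments (F j)) ->
  has_moments (fun w => \sum_(j <- r | Q j) F j w).
Proof.
move=> MF; elim: r => [|j r IH].
  by under eq_fun do rewrite big_nil; exact: has_moments_cst.
case Qj: (Q j); under eq_fun do rewrite big_cons Qj; last exact: IH.
by apply: has_momentsD => //; exact: MF.
Qed.

Lemma Rintegral_sum (J : finType) (Q : pred J) (F : J -> T -> R) :
  (forall j, P.-integrable setT (EFin \o F j)) ->
  \int[P]_w (\sum_(j | Q j) F j w) = \sum_(j | Q j) \int[P]_w F j w.
Proof.
move=> iF; rewrite /Rintegral.
under eq_integral do rewrite -sumEFin.
rewrite integral_sum//= -sum_fine// => j _; exact: integrable_fin_num (iF j).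
Qed.

Lemma Rintegral_prob_cst (a : R) : \int[P]_w a = a.
Proof. rewrite Rintegral_cst//; set p := fine _.
have -> : p = 1 by rewrite /p [X in fine X](probability_setT P).
by rewrite mulr1. Qed.

End Moments.

(** Dropping l = 1 makes the excess over 1 quadratic in t; in [bernstein_moments] that term vanishes
    because the variables are centered. *)
Lemma sum_geometric_gap {R : realFieldType} (t : R) n : 0 <= t -> 2 * t <= 1 ->
  \sum_(l < n | l != 1 :> nat) t ^+ l <= 1 + 2 * t ^+ 2.
Proof.
move=> t0 t1; case: n => [|n]; first by rewrite big_ord0 addr_ge0// mulr_ge0// sqr_ge0.
case: n => [|n].
  rewrite big_mkcond big_ord1 /= expr0 lerDl mulr_ge0 ?sqr_ge0//.
(* The slack carries the induction: adding t^(n+2) leaves -t^(n+2), which is at most -2 t^(n+3)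
   since 2t <= 1. *)
suff h : \sum_(l < n.+2 | l != 1 :> nat) t ^+ l <= 1 + 2 * t ^+ 2 - 2 * t ^+ n.+2.
  by apply: le_trans h _; rewrite gerBl mulr_ge0// exprn_ge0.
elim: n => [|n IH].
  by rewrite big_mkcond big_ord_recl big_ord1 /= expr0 addr0 addrK.
rewrite big_mkcond big_ord_recr -big_mkcond /=.
apply: le_trans (lerD IH (lexx _)) _.
have : 0 <= t ^+ n.+2 by rewrite exprn_ge0.
rewrite (exprSr t n.+2); nra.
Qed.

Section Bernstein.
Context {disp : measure_display} {T : measurableType disp} {R : realType}.
Variable P : probability T R.

(** Induction on N by the binomial formula: the factorials of the two moment bounds cancel the
    binomial coefficient, leaving a geometric series in c/rho without its linear term. Each variable
    thus costs a factor 1 + 2(c/rho)^2. Independence is stated in the form that the expansion uses,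
    and [rho] stays free for optimization. *)
Lemma bernstein_moments (N : nat) (Y : nat -> T -> R) (c rho : R) :
  0 <= c -> 0 < rho -> 2 * c <= rho ->
  (forall n, has_moments P (Y n)) ->
  (forall n l m, (n < N)%N ->
     \int[P]_w (Y n w ^+ l * (\sum_(j < n) Y j w) ^+ m) =
     (\int[P]_w (Y n w ^+ l)) * (\int[P]_w ((\sum_(j < n) Y j w) ^+ m))) ->
  (forall n, (n < N)%N -> \int[P]_w Y n w = 0) ->
  (forall n l, (n < N)%N -> `|\int[P]_w (Y n w ^+ l)| <= l`!%:R * c ^+ l) ->
  forall m, `|\int[P]_w ((\sum_(j < N) Y j w) ^+ m)| <=
    m`!%:R * rho ^+ m * (1 + 2 * (c / rho) ^+ 2) ^+ N.
Proof.
move=> c0 rho0 crho MY; elim: N => [|N IH] indY Y0 Ybd m.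
  under eq_Rintegral do rewrite big_ord0.
  rewrite Rintegral_prob_cst expr0 mulr1; case: m => [|m].
    by rewrite !expr0 fact0 mul1r normr1.
  by rewrite expr0n /= normr0 mulr_ge0// exprn_ge0// ltW.
have {}IH := IH (fun n l m nN => indY n l m (ltnW nN))
               (fun n nN => Y0 n (ltnW nN)) (fun n l nN => Ybd n l (ltnW nN)).
set A := (1 + 2 * (c / rho) ^+ 2); rewrite -/A in IH.
have A0 : 0 <= A by rewrite addr_ge0// mulr_ge0// sqr_ge0.
pose S w := \sum_(j < N) Y j w.
have MS : has_moments P S by apply: has_moments_sum.
have -> : \int[P]_w ((\sum_(j < N.+1) Y j w) ^+ m) =
   \sum_(l < m.+1) 'C(m, l)%:R * ((\int[P]_w (Y N w ^+ l)) * (\int[P]_w (S w ^+ (m - l)))).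
  transitivity (\int[P]_w (\sum_(l < m.+1) 'C(m, l)%:R * (Y N w ^+ l * S w ^+ (m - l)))).
    apply: eq_Rintegral => w _; rewrite big_ord_recr exprDn; apply: eq_bigr => l _.
    by rewrite mulr_natl (mulrC (Y N w ^+ l)).
  have iYS (l : 'I_m.+1) : has_moments P (fun w => Y N w ^+ l * S w ^+ (m - l)).
    by apply: has_momentsM; exact: has_momentsX.
  rewrite Rintegral_sum => [|l]; last first.
    by apply: has_moments_integrable; exact: has_momentsZ.
  apply: eq_bigr => l _; rewrite RintegralZl//; last exact: has_moments_integrable.
  by congr (_ * _); exact: indY.
apply: (@le_trans _ _ (\sum_(l < m.+1 | l != 1 :> nat)
    m`!%:R * rho ^+ m * A ^+ N * (c / rho) ^+ l)); last first.
  rewrite -mulr_sumr exprSr mulrA ler_wpM2l//.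
    by rewrite !mulr_ge0// exprn_ge0// ltW.
  apply: sum_geometric_gap; first by rewrite divr_ge0// ltW.
  by rewrite mulrA ler_pdivrMr// mul1r.
apply: le_trans (ler_norm_sum _ _ _) _.
rewrite [leRHS]big_mkcond; apply: ler_sum => -[l lm] _ /=.
have [->|l1] := eqVneq l 1%N.
  under eq_Rintegral do rewrite expr1.
  by rewrite Y0// mul0r mulr0 normr0.
rewrite ltnS in lm.
rewrite !normrM normr_nat.
apply: (@le_trans _ _ ('C(m, l)%:R *
   ((l`!%:R * c ^+ l) * ((m - l)`!%:R * rho ^+ (m - l) * A ^+ N)))).
  apply: ler_wpM2l => //; apply: ler_pM => //; exact: Ybd.
rewrite -(bin_fact lm) !natrM expr_div_n.
have -> : rho ^+ m = rho ^+ (m - l) * rho ^+ l by rewrite -exprD subnK.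
rewrite le_eqVlt; apply/orP; left; apply/eqP.
field; rewrite expf_neq0// gt_eqF//.
Qed.

Lemma measurable_norm_gt (f : T -> R) (t : R) : measurable_fun setT f ->
  measurable [set w | (t < `|f w|)%R].
Proof.
move=> mf; rewrite [X in measurable X](_ : _ = (fun w => `|f w|) @^-1` `]t, +oo[).
  rewrite -[X in measurable X]setTI.
  by apply: (measurableT_comp (@normr_measurable R setT) mf).
by apply/seteqP; split=> w /=; rewrite in_itv /= andbT.
Qed.

Lemma markov_moment (f : T -> R) (t : R) n : has_moments P f -> 0 < t ->
  (P [set w | (t < `|f w|)%R] <= ((\int[P]_w (f w ^+ (2 * n))) / t ^+ (2 * n))%:E)%E.
Proof.
move=> Mf t0; have mf := has_moments_measurable Mf.
pose X : {mfun T >-> R} :=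
  MeasurableFun.Pack (MeasurableFun.Class (isMeasurableFun.Build _ _ _ _ _ mf)).
pose h (r : R) := r ^+ (2 * n).
have tn : 0 < t ^+ (2 * n) by rewrite exprn_gt0.
rewrite mulrC EFinM lee_pdivlMl//.
have := @markov _ _ _ P X h t t0 _ _ _.
have -> : ('E_P[h \o (fun x => `|x|%R) \o X] = (\int[P]_w (f w ^+ (2 * n)))%:E)%E.
  rewrite unlock fineK; last first.
    by apply: integrable_fin_num => //; case: Mf => _; apply.
  apply: eq_integral => w _; rewrite /h /= -normrX ger0_norm//.
  by rewrite exprn_even_ge0// mul2n odd_double.
move=> H; apply: le_trans (H _ _ _).
- rewrite lee_pmul2l//. apply: le_measure; rewrite ?inE//=.
  + exact: measurable_norm_gt.
  + rewrite [X in measurable X](_ : _ = (fun w => `|f w|) @^-1` `[t, +oo[).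
      rewrite -[X in measurable X]setTI.
      by apply: (measurableT_comp (@normr_measurable R setT) mf).
    by apply/seteqP; split=> w /=; rewrite in_itv /= andbT.
  + by move=> w /= /ltW.
- exact: exprn_measurable.
- by move=> r r0; rewrite exprn_ge0.
- by move=> x y; rewrite !nnegrE => x0 y0 xy; rewrite lerXn2r ?nnegrE.
Qed.

End Bernstein.

Section Adapted.
Context {disp : measure_display} {T : measurableType disp} {R : realType}.
Variable P : probability T R.
Variables (I : finType) (X : I -> {RV P >-> R}).
Hypothesis indX : mutually_independent X.

(** Stated through [g_sigma_algebraType], so that the usual closure properties of measurable
    functions apply to the sigma-algebra of the coordinates in [J]. *)
Definition adapted (J : set I) (f : T -> R) :=
  measurable_fun (setT : set (g_sigma_algebraType (cylinder_generators X J)))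
    (f : g_sigma_algebraType (cylinder_generators X J) -> R).

Lemma adapted_sub (J K : set I) f : J `<=` K -> adapted J f -> adapted K f.
Proof.
move=> JK af _ B mB; have := af measurableT B mB.
apply: sub_sigma_algebra2 => C [i Ji]; exists i => //; exact: JK.
Qed.

Lemma adapted_coord (J : set I) i : J i -> adapted J (X i).
Proof.
move=> Ji _ B mB; apply: sub_sigma_algebra; exists i => //; by exists B.
Qed.

Lemma adapted_sum J (n : nat) (F : nat -> T -> R) :
  (forall j, (j < n)%N -> adapted J (F j)) -> adapted J (fun w => \sum_(j < n) F j w).
Proof.
elim: n => [|n IH] aF.
  by under eq_fun do rewrite big_ord0; exact: measurable_cst.
under eq_fun do rewrite big_ord_recr /=.
apply: measurable_funD; last exact: aF.
by apply: IH => j jn; apply: aF; exact: ltnW.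
Qed.

Lemma Rintegral_rest (J : set I) i (phi : R -> R) (W : T -> R) :
  ~ J i -> measurable_fun setT phi -> adapted J W ->
  has_moments P (phi \o X i) -> has_moments P W ->
  \int[P]_w (phi (X i w) * W w) = (\int[P]_w phi (X i w)) * (\int[P]_w W w).
Proof.
move=> Ji mphi aW Mphi MW; apply: (@Rintegral_independent _ _ _ P (phi \o X i)).
- exact: has_moments_integrable.
- exact: has_moments_integrable.
- by apply: has_moments_integrable; exact: has_momentsM.
move=> A B mA mB; rewrite setIC [RHS]muleC.
apply: (@independent_rest _ _ _ P I X indX J i (W @^-1` B) (phi @^-1` A)) => //.
  by have := aW measurableT B mB; rewrite setTI.
by rewrite -[X in measurable X]setTI; exact: mphi.
Qed.

End Adapted.

(** * Normal and Bernoulli variables *)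

Section NormalIntegrals.
Variable R : realType.
Local Notation mu := (@lebesgue_measure R).
Local Open Scope ereal_scope.

(** The Radon-Nikodym derivative of the normal law agrees almost everywhere with [normal_pdf], since
    both have the same integral over every measurable set. *)
Lemma ge0_integral_normal_prob (f : R -> \bar R) :
  measurable_fun setT f -> (forall x, 0 <= f x) ->
  \int[normal_prob 0 1]_x f x = \int[mu]_x (f x * (normal_pdf 0 1 x)%:E).
Proof.
move=> mf f0.
pose nu : {finite_measure set (measurableTypeR R) -> \bar R} := normal_prob (0:R) 1.
have dom : nu `<< mu by exact: normal_prob_dominates.
rewrite -[LHS](Radon_Nikodym_SigmaFinite.change_of_variables dom f0 measurableT mf).
have i_g := Radon_Nikodym_SigmaFinite.f_integrable dom.
apply: ae_eq_integral => //.
- by apply: emeasurable_funM => //; exact: measurable_int i_g.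
- apply: emeasurable_funM => //; apply/measurable_EFinP; exact: measurable_normal_pdf.
- apply: ae_eqe_mul2l; apply: integral_ae_eq => //.
    by apply/measurable_EFinP; exact: measurable_normal_pdf.
  by move=> E ET mE; rewrite -(Radon_Nikodym_SigmaFinite.f_integral dom).
Qed.

(** Since 1 - 2t = 1/s^2, the integrand is s times the centered normal density of standard deviation
    s. *)
Lemma integral_expR_sqr_normal (t s : R) : (0 < s)%R -> ((1 - 2 * t) * s ^+ 2 = 1)%R ->
  \int[normal_prob 0 1]_x (expR (t * x ^+ 2))%:E = s%:E.
Proof.
move=> s0 ts; rewrite ge0_integral_normal_prob.
- have s2 : (s ^+ 2 != 0)%R by rewrite sqrf_eq0 gt_eqF.
  rewrite (eq_integral (fun x : measurableTypeR R => s%:E * (normal_pdf 0 s x)%:E)).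
    rewrite ge0_integralZl//.
    + by rewrite integral_normal_pdf mule1.
    + by apply/measurable_EFinP; exact: measurable_normal_pdf.
    + by move=> x _; rewrite lee_fin normal_pdf_ge0.
    + by rewrite lee_fin ltW.
  move=> x _; rewrite -!EFinM; congr EFin.
  rewrite !normal_pdfE ?oner_eq0 ?gt_eqF// /normal_peak /normal_fun !subr0.
  rewrite mulrCA -expRD [RHS]mulrA; congr (_ * _)%R.
    rewrite expr1n mul1r -mulrnAr sqrtrM ?sqr_ge0// sqrtr_sqr gtr0_norm//.
    by rewrite invfM mulVKf ?gt_eqF.
  have -> : (t = 2^-1 * (1 - (s ^+ 2)^-1))%R.
    by have -> : ((s ^+ 2)^-1 = 1 - 2 * t)%R by [rewrite -[RHS](mulfK s2) ts mul1r]; lra.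
  by congr expR; rewrite expr1n !mulr2n; field;
    apply/andP; split; rewrite gt_eqF// addr_gt0// exprn_gt0.
- apply/measurable_EFinP; apply: measurableT_comp => //.
  by apply: measurable_funM => //; exact: exprn_measurable.
- by move=> x; rewrite lee_fin expR_ge0.
Qed.

(** Completing the square turns the integrand into e^(t^2/2) times the normal density of mean t. *)
Lemma integral_expR_normal (t : R) :
  \int[normal_prob 0 1]_x (expR (t * x))%:E = (expR (t ^+ 2 / 2))%:E.
Proof.
rewrite ge0_integral_normal_prob.
- rewrite (eq_integral (fun x : measurableTypeR R =>
    (expR (t ^+ 2 / 2))%:E * (normal_pdf t 1 x)%:E)).
    rewrite ge0_integralZl//.
    + by rewrite integral_normal_pdf mule1.
    + by apply/measurable_EFinP; exact: measurable_normal_pdf.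
    + by move=> x _; rewrite lee_fin normal_pdf_ge0.
  move=> x _; rewrite -!EFinM; congr EFin.
  rewrite !normal_pdfE ?oner_eq0// /normal_fun !subr0.
  rewrite mulrCA [RHS]mulrCA -!expRD; congr (_ * expR _)%R.
  by rewrite expr1n !mulr2n; field.
- by apply/measurable_EFinP; apply: measurableT_comp.
- by move=> x; rewrite lee_fin expR_ge0.
Qed.

End NormalIntegrals.

(** A linear term dominated by a quadratic one near 0, for both signs of t, must vanish. This
    extracts the mean and variance of a normal variable from exponential integrals. *)
Lemma eq0_quadratic_bound {R : realFieldType} (m : R) :
  (forall t, -8^-1 <= t <= 8^-1 -> t * m <= 2 * t ^+ 2) -> m = 0.
Proof.
move=> H; apply/eqP; rewrite -sqrf_eq0 eq_le sqr_ge0 andbT.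
have m2 := sqr_ge0 m.
pose d := 8 * (1 + m ^+ 2); have d0 : 0 < d by rewrite /d; lra.
have /H : - 8^-1 <= m / d <= 8^-1.
  by rewrite ler_pdivlMr// ler_pdivrMr// /d; apply/andP; split; nra.
have -> : 2 * (m / d) ^+ 2 = (2 * m ^+ 2 / d) / d by field; rewrite gt_eqF.
have -> : m / d * m = m ^+ 2 / d by field; rewrite gt_eqF.
rewrite ler_pM2r ?invr_gt0// ler_pdivlMr// /d; nra.
Qed.

Section UnitVariates.
Context {disp : measure_display} {T : measurableType disp} {R : realType}.
Variable P : probability T R.
Implicit Type X : {RV P >-> R}.

(** The factorial growth of the 2l-th moment makes X^2 - 1, and products of two independent
    coordinates, satisfy the [l! c^l] hypothesis of [bernstein_moments]. *)
Definition unit_variate (f : T -> R) :=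
  [/\ has_moments P f, \int[P]_w f w = 0, \int[P]_w (f w ^+ 2) = 1 &
      forall l, \int[P]_w (f w ^+ (2 * l)) <= 2 * 4 ^+ l * l`!%:R].

Lemma ge0_integral_standard_normal X (phi : R -> R) : standard_normal X ->
  measurable_fun setT phi -> (forall x, 0 <= phi x) ->
  (\int[P]_w (phi (X w))%:E = \int[normal_prob 0 1]_x (phi x)%:E)%E.
Proof.
move=> nX mphi phi0.
(* The normal law lives on [measurableTypeR R], a different measurable structure
   on the reals from the default one (with the same measurable sets). *)
have mX : measurable_fun setT (X : T -> measurableTypeR R).
  by move=> mT B mB; apply: (@measurable_funP _ _ _ _ setT X mT B).
pose Y : {mfun T >-> measurableTypeR R} :=
  MeasurableFun.Pack (MeasurableFun.Class (isMeasurableFun.Build _ _ _ _ _ mX)).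
have := @ge0_integral_distribution _ _ T (measurableTypeR R) R P Y (EFin \o phi).
move=> <- //; last by apply/measurable_EFinP.
by apply: eq_measure_integral => A mA _; exact: nX.
Qed.

Lemma Rintegral_standard_normal X (phi : R -> R) s : standard_normal X ->
  measurable_fun setT phi -> (forall x, 0 <= phi x) ->
  (\int[normal_prob 0 1]_x (phi x)%:E = s%:E)%E ->
  P.-integrable setT (EFin \o (phi \o X)) /\ \int[P]_w phi (X w) = s.
Proof.
move=> nX mphi phi0 e; have h := ge0_integral_standard_normal nX mphi phi0.
split; last by rewrite /Rintegral h e.
apply/integrableP; split; first by apply/measurable_EFinP; exact: measurableT_comp.
under eq_integral do rewrite /= ger0_norm//.
by rewrite h e ltry.
Qed.

Lemma standard_normal_unit_variate X : standard_normal X -> unit_variate X.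
Proof.
move=> nX.
have sqX t s : 0 < s -> (1 - 2 * t) * s ^+ 2 = 1 ->
    P.-integrable setT (EFin \o (fun w => expR (t * X w ^+ 2))) /\
    \int[P]_w expR (t * X w ^+ 2) = s.
  move=> s0 ts; apply: (@Rintegral_standard_normal X (fun x => expR (t * x ^+ 2))) => //.
  - by apply: measurableT_comp => //; apply: measurable_funM => //; exact: exprn_measurable.
  - exact: integral_expR_sqr_normal.
have linX t : P.-integrable setT (EFin \o (fun w => expR (t * X w))) /\
    \int[P]_w expR (t * X w) = expR (t ^+ 2 / 2).
  apply: (@Rintegral_standard_normal X (fun x => expR (t * x))) => //.
  - by apply: measurableT_comp => //; apply: measurable_funM.
  - exact: integral_expR_normal.
(* At t = 1/4 the integral is sqrt 2, and the l-th term of the series of e^(X^2/4) gives the factor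
   4^l l! of the moment bound. *)
have [i4 e4] : P.-integrable setT (EFin \o (fun w => expR (4^-1 * X w ^+ 2))) /\
    \int[P]_w expR (4^-1 * X w ^+ 2) = Num.sqrt 2.
  by apply: sqX; rewrite ?sqrtr_gt0// sqr_sqrtr//; lra.
have bound l w : X w ^+ (2 * l) <= 4 ^+ l * l`!%:R * expR (4^-1 * X w ^+ 2).
  have := @expr_le_fact_expR R (4^-1 * X w ^+ 2) l.
  rewrite mulr_ge0 ?sqr_ge0// => /(_ isT).
  rewrite exprMn exprVn ler_pdivrMl ?exprn_gt0// -exprM mulrA.
  exact.
have MX : has_moments P X.
  split=> // m.
  apply: (@dominated_integrable _ _ _ _ _
    (fun w => 1 + 4 ^+ m * m`!%:R * expR (4^-1 * X w ^+ 2))).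
  - exact: measurable_funX.
  - apply: integrableD_fun; last exact: integrableZ_fun.
    exact: has_moments_integrable (has_moments_cst P 1).
  - move=> w; apply: le_trans (lerD (lexx 1) (bound m w)).
    rewrite mulnC exprM -(real_normK (num_real (X w ^+ m))).
    have := normr_ge0 (X w ^+ m); nra.
have i1 := has_moments_integrable (has_moments_cst P 1).
have iX := has_moments_integrable MX.
have iX2 := has_moments_integrable (has_momentsX 2 MX).
split => //.
(* Mean: 1 + tX <= e^(tX) gives t E X <= e^(t^2/2) - 1 <= t^2. *)
- apply: eq0_quadratic_bound => t /andP[t1 t2].
  have [it et] := linX t.
  have : \int[P]_w (1 + t * X w) <= expR (t ^+ 2 / 2).
    rewrite -et; apply: le_Rintegral => //.
      by apply: integrableD_fun => //; exact: integrableZ_fun.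
    by move=> w _; exact: expR_ge1Dx.
  rewrite RintegralD//; last exact: integrableZ_fun.
  rewrite RintegralZl// Rintegral_prob_cst.
  have : expR (t ^+ 2 / 2) <= 1 + t ^+ 2.
    rewrite -[expR _]invrK -expRN; have := expR_ge1Dx (- (t ^+ 2 / 2)).
    set e := expR _ => he.
    have e0 : 0 < e by exact: expR_gt0.
    have u0 := sqr_ge0 t; have u1 : t ^+ 2 <= 1 by nra.
    have u2 : 0 <= 1 + t ^+ 2 by lra.
    rewrite -div1r ler_pdivrMr//; apply: le_trans (ler_wpM2l u2 he); nra.
  nra.
(* Variance: 1 + t E X^2 <= E e^(tX^2) = (1 - 2t)^(-1/2) <= 1 + t + 2t^2. *)
- apply/eqP; rewrite -subr_eq0; apply/eqP.
  apply: eq0_quadratic_bound => t /andP[t1 t2].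
  pose s := Num.sqrt (1 - 2 * t)^-1.
  have t3 : 0 < 1 - 2 * t by lra.
  have s0 : 0 < s by rewrite sqrtr_gt0 invr_gt0.
  have s2 : (1 - 2 * t) * s ^+ 2 = 1.
    by rewrite sqr_sqrtr ?invr_ge0 ?(ltW t3)// divff// gt_eqF.
  have [it et] := sqX t s s0 s2.
  have : \int[P]_w (1 + t * X w ^+ 2) <= s.
    rewrite -et; apply: le_Rintegral => //.
      by apply: integrableD_fun => //; exact: integrableZ_fun.
    by move=> w _; exact: expR_ge1Dx.
  rewrite RintegralD//; last exact: integrableZ_fun.
  rewrite RintegralZl// Rintegral_prob_cst.
  have : s <= 1 + t + 2 * t ^+ 2.
    have u0 : 0 <= 1 + t + 2 * t ^+ 2 by nra.
    rewrite -(@ler_pXn2r _ 2)// ?nnegrE ?(ltW s0)// -(ler_pM2l t3) s2.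
    have : 0 <= t ^+ 2 * (1 - 6 * t - 4 * t ^+ 2 - 8 * t ^+ 3).
      rewrite mulr_ge0 ?sqr_ge0//.
      have : t ^+ 2 <= 8^-1 ^+ 2 by rewrite !expr2; nra.
      have t2' : 0 <= t ^+ 2 by exact: sqr_ge0.
      have -> : t ^+ 3 = t * t ^+ 2 by rewrite exprS.
      by set u := t ^+ 2 in t2' *; nra.
    by move=> h; rewrite -subr_ge0; apply: le_trans h _; rewrite le_eqVlt;
      apply/orP; left; apply/eqP; ring.
  nra.
- move=> l; have -> : 2 * 4 ^+ l * l`!%:R = 4 ^+ l * l`!%:R * 2 :> R by ring.
  apply: (@le_trans _ _ (4 ^+ l * l`!%:R * Num.sqrt 2)).
    rewrite -e4 -RintegralZl//; apply: le_Rintegral => //.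
    + by case: MX => _; apply.
    + exact: integrableZ_fun.
  rewrite ler_wpM2l ?mulr_ge0 ?exprn_ge0//.
  by rewrite -(@ler_pXn2r _ 2)// ?nnegrE ?sqrtr_ge0// sqr_sqrtr//; lra.
Qed.

End UnitVariates.

Section VariateSums.
Context {disp : measure_display} {T : measurableType disp} {R : realType}.
Variable P : probability T R.

Let one_neqN1 : 1 != -1 :> R.
Proof. by rewrite gt_eqF//; lra. Qed.

Lemma sign_bernoulli_ae (X : {RV P >-> R}) : sign_bernoulli X ->
  P (~` (X @^-1` [set 1] `|` X @^-1` [set -1])) = 0%E.
Proof.
move=> [X1 XN1].
have m1 r : measurable (X @^-1` [set r]).
  by rewrite -[X in measurable X]setTI; exact: measurable_funP.
rewrite probability_setC; last exact: measurableU.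
rewrite measureU//; last first.
  by apply/seteqP; split=> w //= [-> /eqP]; rewrite (negPf one_neqN1).
rewrite [X in (_ - (X + _))%E]X1 [X in (_ - (_ + X))%E]XN1.
have -> : ((2^-1)%:E + (2^-1)%:E = 1 :> \bar R)%E.
  by rewrite -EFinD; congr EFin; lra.
by rewrite subee.
Qed.

(** Almost everywhere X^m is the indicator combination [g m], so the even moments are 1 and the odd
    ones 0. *)
Lemma sign_bernoulli_unit_variate (X : {RV P >-> R}) : sign_bernoulli X -> unit_variate P X.
Proof.
move=> bX; have [X1 XN1] := bX.
pose A := X @^-1` [set 1]; pose B := X @^-1` [set -1].
have mA : measurable A by rewrite -[X in measurable X]setTI; exact: measurable_funP.
have mB : measurable B by rewrite -[X in measurable X]setTI; exact: measurable_funP.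
pose g m w : R := \1_A w + (-1) ^+ m * \1_B w.
have iA : P.-integrable setT (EFin \o \1_A) by exact: integrable_indic.
have iB : P.-integrable setT (EFin \o \1_B) by exact: integrable_indic.
have i_g m : P.-integrable setT (EFin \o g m).
  by apply: integrableD_fun => //; exact: integrableZ_fun.
have Eg m : \int[P]_w g m w = 2^-1 + (-1) ^+ m * 2^-1.
  rewrite RintegralD//; last exact: integrableZ_fun.
  by rewrite RintegralZl// /Rintegral !integral_indic// !setIT
    [X in fine X + _]X1 [X in _ + _ * fine X]XN1.
have XE m : ae_eq P setT (fun w => (X w ^+ m)%:E) (EFin \o g m).
  exists (~` (A `|` B)); split.
  - by apply: measurableC; exact: measurableU.
  - exact: sign_bernoulli_ae.
  - move=> w /= nE; apply: contra_not nE => -[] /= Xw _; congr EFin; rewrite /g !indicE.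
      rewrite mem_set// memNset ?mulr0 ?addr0 ?Xw ?expr1n//= /B /= Xw => /eqP.
      by rewrite (negPf one_neqN1).
    rewrite [w \in B]mem_set// memNset ?add0r ?mulr1 ?Xw//= /A /= Xw => /eqP.
    by rewrite eq_sym (negPf one_neqN1).
have mX m : measurable_fun setT (fun w => (X w ^+ m)%:E).
  by apply/measurable_EFinP; exact: measurable_funX.
have EX m : \int[P]_w (X w ^+ m) = 2^-1 + (-1) ^+ m * 2^-1.
  rewrite -Eg; congr fine; apply: ae_eq_integral => //; exact: measurable_int (i_g m).
split.
- split=> // m; apply/integrableP; split; first exact: mX.
  case/integrableP: (i_g m) => mg h; apply: le_lt_trans h.
  rewrite le_eqVlt; apply/orP; left; apply/eqP.
  apply: ae_eq_integral => //; [|exact: measurableT_comp|].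
    by apply: measurableT_comp => //; exact: mX.
  case: (XE m) => N [mN N0 sub]; exists N; split=> // w /= nE.
  apply: sub => /= XEw; apply: nE => wT; have := XEw wT => -[XEw1]; by rewrite XEw1.
- by have := EX 1%N; under eq_Rintegral do rewrite expr1; move=> ->; rewrite expr1 mulN1r subrr.
- by rewrite EX expr2 mulN1r opprK mul1r; lra.
- move=> l; rewrite EX exprM sqrrN !expr1n mul1r.
  rewrite -mulrA; apply: (@le_trans _ _ (2 * 1)); first by lra.
  by rewrite ler_wpM2l// mulr_ege1 ?exprn_ege1 ?ler1n ?fact_gt0.
Qed.

(** The choice rho^2 = 4c^2 N/q gives (c/rho)^2 = q/(4N), so the product of N factors is at most
    e^(q/2) <= 4^q; q <= N is exactly what 2c <= rho requires. With (2q)! <= (2q)^(2q) the constant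
    is 4 * 4 * 4 = 64. *)
Lemma bernstein_even_moments (N q : nat) (Y : nat -> T -> R) (c : R) :
  0 < c -> (0 < q <= N)%N ->
  (forall n, has_moments P (Y n)) ->
  (forall n l m, (n < N)%N ->
     \int[P]_w (Y n w ^+ l * (\sum_(j < n) Y j w) ^+ m) =
     (\int[P]_w (Y n w ^+ l)) * (\int[P]_w ((\sum_(j < n) Y j w) ^+ m))) ->
  (forall n, (n < N)%N -> \int[P]_w Y n w = 0) ->
  (forall n l, (n < N)%N -> `|\int[P]_w (Y n w ^+ l)| <= l`!%:R * c ^+ l) ->
  \int[P]_w ((\sum_(j < N) Y j w) ^+ (2 * q)) <= (64 * c ^+ 2 * q%:R * N%:R) ^+ q.
Proof.
move=> c0 /andP[q0 qN] MY indY Y0 Ybd.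
have qR0 : 0 < q%:R :> R by rewrite ltr0n.
have NR0 : 0 < N%:R :> R by rewrite ltr0n (leq_trans q0).
have qNR : q%:R <= N%:R :> R by rewrite ler_nat.
pose rho := Num.sqrt (4 * c ^+ 2 * N%:R / q%:R).
have c2 : 0 < c ^+ 2 by rewrite exprn_gt0.
have rho2 : rho ^+ 2 = 4 * c ^+ 2 * N%:R / q%:R.
  by rewrite sqr_sqrtr// divr_ge0 ?mulr_ge0// ltW.
have rho0 : 0 < rho by rewrite sqrtr_gt0 divr_gt0 ?mulr_gt0.
have crho : 2 * c <= rho.
  have c20 : 0 <= 2 * c by rewrite mulr_ge0// ltW.
  rewrite -(@ler_pXn2r _ 2)// ?nnegrE ?(ltW rho0)// rho2 exprMn ler_pdivlMr//.
  by have -> : 2 ^+ 2 = 4 :> R by [lra]; rewrite ler_pM2l// mulr_gt0.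
have := @bernstein_moments _ _ _ P N Y c rho (ltW c0) rho0 crho MY indY Y0 Ybd (2 * q).
move=> /(le_trans (ler_norm _)) /le_trans; apply.
have -> : (c / rho) ^+ 2 = q%:R / N%:R / 4.
  by rewrite expr_div_n rho2; field; rewrite !gt_eqF.
rewrite exprM rho2.
have -> : 64 * c ^+ 2 * q%:R * N%:R = (2 * q%:R) ^+ 2 * (4 * c ^+ 2 * N%:R / q%:R) * 4.
  by field; rewrite gt_eqF.
rewrite [leRHS]exprMn; apply: ler_pM.
- by rewrite mulr_ge0// exprn_ge0// -rho2 sqr_ge0.
- by rewrite exprn_ge0// addr_ge0 ?mulr_ge0 ?divr_ge0// ltW.
- rewrite [leRHS]exprMn ler_wpM2r//; first by rewrite exprn_ge0// -rho2 sqr_ge0.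
  by rewrite -exprM -natrM -natrX ler_nat; exact: factn_le_expn.
apply: (@le_trans _ _ (expR (2 * (q%:R / N%:R / 4)) ^+ N)).
  by rewrite lerXn2r ?nnegrE ?expR_ge0 ?expR_ge1Dx// addr_ge0 ?mulr_ge0 ?divr_ge0// ltW.
rewrite -expRM_natr.
apply: (@le_trans _ _ (expR (1 * q%:R))).
  rewrite ler_expR mul1r.
  have -> : 2 * (q%:R / N%:R / 4) * N%:R = q%:R / 2 :> R by field; rewrite gt_eqF.
  lra.
by rewrite expRM_natr lerXn2r ?nnegrE ?expR_ge0// expR1_le4.
Qed.

End VariateSums.

(** * Sums of squares and autocorrelations *)

Section IndependentUnitVariates.
Context {disp : measure_display} {T : measurableType disp} {R : realType}.
Variable P : probability T R.
Variables (I : finType) (X : I -> {RV P >-> R}).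
Hypothesis indX : mutually_independent X.
Hypothesis unitX : forall i, unit_variate P (X i).

Let MX i : has_moments P (X i). Proof. by case: (unitX i). Qed.

Let M1 : has_moments P (fun=> 1). Proof. exact: has_moments_cst. Qed.

Lemma has_moments_square_deviation i : has_moments P (fun w => X i w ^+ 2 - 1).
Proof. by apply: has_momentsD; [exact: has_momentsX|exact: has_moments_cst]. Qed.

(** In 24 = 2 * 4 * 3, the 2 comes from |x^2 - 1|^l <= 2^l (x^(2l) + 1), the 4 from [unit_variate],
    and the 3 absorbs its leading 2 and the summand 1 when l > 0. *)
Lemma square_deviation_moment i l :
  `|\int[P]_w ((X i w ^+ 2 - 1) ^+ l)| <= l`!%:R * 24 ^+ l.
Proof.
case: l => [|l].
  under eq_Rintegral do rewrite expr0.
  by rewrite Rintegral_prob_cst normr1 expr0 mulr1 fact0.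
have [_ _ _ EX] := unitX i.
have MXd := has_momentsX l.+1 (has_moments_square_deviation i).
have MX2 := has_momentsX (2 * l.+1) (MX i).
apply: le_trans (le_normr_Rintegral _ _) _ => //; first exact: has_moments_integrable.
have bound (x : R) : `|(x ^+ 2 - 1) ^+ l.+1| <= 2 ^+ l.+1 * (x ^+ (2 * l.+1) + 1).
  rewrite normrX; have x2 := sqr_ge0 x; have a0 := normr_ge0 (x ^+ 2 - 1).
  have -> : 2 ^+ l.+1 * (x ^+ (2 * l.+1) + 1) = (2 * x ^+ 2) ^+ l.+1 + 2 ^+ l.+1.
    by rewrite mulrDr mulr1 exprM [in RHS]exprMn.
  have u0 : 0 <= 2 * x ^+ 2 by rewrite mulr_ge0.
  have [h|h] := leP (x ^+ 2) 1.
    apply: (@le_trans _ _ (2 ^+ l.+1)).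
      have hx : `|x ^+ 2 - 1| <= 2 by rewrite ler_norml; lra.
      by apply: lerXn2r; rewrite ?nnegrE.
    by rewrite lerDr exprn_ge0.
  apply: (@le_trans _ _ ((2 * x ^+ 2) ^+ l.+1)).
    have hx : `|x ^+ 2 - 1| <= 2 * x ^+ 2 by rewrite ler_norml; lra.
    by apply: lerXn2r; rewrite ?nnegrE.
  by rewrite lerDl exprn_ge0.
have i1 := has_moments_integrable M1.
have i2 := has_moments_integrable MX2.
apply: (@le_trans _ _ (\int[P]_w (2 ^+ l.+1 * (X i w ^+ (2 * l.+1) + 1)))).
  apply: le_Rintegral => //.
  - apply: (@dominated_integrable _ _ _ _ _ (fun w => `|(X i w ^+ 2 - 1) ^+ l.+1|)).
    + apply: measurableT_comp => //; exact: has_moments_measurable MXd.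
    + have [_ /(_ 1%N)] := MXd.
      by under eq_fun do rewrite /comp expr1; move=> /integrable_norm.
    + by move=> w; rewrite normr_id.
  - by apply: integrableZ_fun; exact: integrableD_fun.
rewrite RintegralZl//; last exact: integrableD_fun.
rewrite RintegralD// Rintegral_prob_cst.
have f1 : 1 <= l.+1`!%:R :> R by rewrite ler1n fact_gt0.
have p4 : 1 <= 4 ^+ l.+1 :> R by rewrite exprn_ege1//; lra.
have p3 : 3 <= 3 ^+ l.+1 :> R by rewrite exprS ler_peMr// exprn_ege1//; lra.
have -> : 24 = 2 * 4 * 3 :> R by lra.
rewrite !exprMn.
apply: (@le_trans _ _ (2 ^+ l.+1 * (3 * (4 ^+ l.+1 * l.+1`!%:R)))).
  rewrite ler_wpM2l ?exprn_ge0//.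
  have : 1 <= 4 ^+ l.+1 * l.+1`!%:R :> R by rewrite mulr_ege1.
  have := EX l.+1; rewrite -(mulrA 2); lra.
have -> : l.+1`!%:R * (2 ^+ l.+1 * 4 ^+ l.+1 * 3 ^+ l.+1) =
  2 ^+ l.+1 * (3 ^+ l.+1 * (4 ^+ l.+1 * l.+1`!%:R)) :> R by ring.
by rewrite ler_wpM2l ?exprn_ge0// ler_wpM2r// mulr_ge0// exprn_ge0.
Qed.

(** Cauchy-Schwarz, obtained by integrating 2mx <= x^2 + m^2. Bounding the square lets a product of
    moments of two independent coordinates stay below l! 24^l. *)
Lemma sqr_moment_le i l : (\int[P]_w (X i w ^+ l)) ^+ 2 <= l`!%:R * 24 ^+ l.
Proof.
case: l => [|l].
  under eq_Rintegral do rewrite expr0.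
  by rewrite Rintegral_prob_cst expr1n expr0 mulr1 fact0.
have [_ _ _ EX] := unitX i; set m := Rintegral _ _ _.
have i1 := has_moments_integrable (has_momentsX l.+1 (MX i)).
have i2 := has_moments_integrable (has_momentsX (2 * l.+1) (MX i)).
have : 2 * m * m <= \int[P]_w (X i w ^+ (2 * l.+1) + m ^+ 2).
  rewrite -RintegralZl//; apply: le_Rintegral => //.
  - exact: integrableZ_fun.
  - by apply: integrableD_fun => //; exact: has_moments_integrable (has_moments_cst _ _).
  - move=> w _; rewrite mulnC exprM -subr_ge0.
    by have -> : X i w ^+ l.+1 ^+ 2 + m ^+ 2 - 2 * m * X i w ^+ l.+1 = (X i w ^+ l.+1 - m) ^+ 2
      by [ring]; exact: sqr_ge0.
rewrite RintegralD//; last exact: has_moments_integrable (has_moments_cst _ _).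
rewrite Rintegral_prob_cst => h.
apply: (@le_trans _ _ (2 * 4 ^+ l.+1 * l.+1`!%:R)); first by have := EX l.+1; nra.
rewrite mulrC ler_wpM2l//.
have -> : 24 = 6 * 4 :> R by lra.
rewrite exprMn ler_wpM2r ?exprn_ge0//.
have : 1 <= 6 ^+ l :> R by rewrite exprn_ege1//; lra.
rewrite exprS; lra.
Qed.

Lemma square_sum_moment (k q : nat) (p : nat -> I) : (0 < q <= k)%N ->
  (forall i j, (i < k)%N -> (j < k)%N -> p i = p j -> i = j) ->
  \int[P]_w ((\sum_(j < k) (X (p j) w ^+ 2 - 1)) ^+ (2 * q))
    <= (64 * 24 ^+ 2 * q%:R * k%:R) ^+ q.
Proof.
move=> qk injp.
apply: (@bernstein_even_moments _ _ _ P k q (fun j w => X (p j) w ^+ 2 - 1)) => //.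
- by move=> n; exact: has_moments_square_deviation.
- move=> n l m nk.
  pose J : set I := [set p j | j in [set j | (j < n)%N]].
  apply: (@Rintegral_rest _ _ _ P I X indX J (p n) (fun x => (x ^+ 2 - 1) ^+ l)
            (fun w => (\sum_(j < n) (X (p j) w ^+ 2 - 1)) ^+ m)).
  + move=> [j /= jn /injp pj]; suff : j = n by move=> jn'; rewrite jn' ltnn in jn.
    by apply: pj => //; exact: ltn_trans jn nk.
  + apply: measurable_funX; apply: measurable_funB => //; exact: exprn_measurable.
  + apply: measurable_funX.
    apply: (@adapted_sum _ _ _ P I X J n (fun j w => X (p j) w ^+ 2 - 1)) => j jn.
    apply: measurable_funB => //; apply: measurable_funX.
    by apply: adapted_coord; exists j.
  + exact: has_momentsX (has_moments_square_deviation _).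
  + by apply/has_momentsX/has_moments_sum => j _; exact: has_moments_square_deviation.
- move=> n _; have [_ _ EX2 _] := unitX (p n).
  rewrite RintegralB//; last 2 first.
    exact: has_moments_integrable (has_momentsX 2 (MX _)).
    exact: has_moments_integrable M1.
  by rewrite EX2 Rintegral_prob_cst subrr.
- by move=> n l _; exact: square_deviation_moment.
Qed.

(** No coordinate occurs in two retained products: p and r are injective, and the retained p-values
    lie in [v] while the r-values do not. Discarded terms are kept as zeros, so the sum still has k
    terms. *)
Lemma matching_sum_moment (k q : nat) (p r : nat -> I) (v : I -> bool) : (0 < q <= k)%N ->
  (forall i j, (i < k)%N -> (j < k)%N -> p i = p j -> i = j) ->
  (forall i j, (i < k)%N -> (j < k)%N -> r i = r j -> i = j) ->
  \int[P]_w ((\sum_(j < k | v (p j) && ~~ v (r j)) X (p j) w * X (r j) w) ^+ (2 * q))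
    <= (64 * 24 ^+ 2 * q%:R * k%:R) ^+ q.
Proof.
move=> qk injp injr.
pose Y j w := if v (p j) && ~~ v (r j) then X (p j) w * X (r j) w else 0.
under eq_Rintegral do rewrite big_mkcond.
have Yt n : v (p n) && ~~ v (r n) -> Y n = fun w => X (p n) w * X (r n) w.
  by move=> vn; apply/funext => w; rewrite /Y vn.
have Yf n : ~~ (v (p n) && ~~ v (r n)) -> Y n = fun=> 0.
  by move=> /negbTE vn; apply/funext => w; rewrite /Y vn.
have MY n : has_moments P (Y n).
  have [/Yt ->|/Yf ->] := boolP (v (p n) && ~~ v (r n)); last exact: has_moments_cst.
  exact: has_momentsM.
(* The factors are split off one at a time: [p n] from everything else, with [r n] joined to [J],
   then [r n]. They differ because only [p n] lies in [v]. *)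
have split2 n l W (J : set I) : v (p n) -> ~~ v (r n) -> ~ J (p n) -> ~ J (r n) ->
    adapted X J W -> has_moments P W ->
    \int[P]_w ((X (p n) w * X (r n) w) ^+ l * W w) =
    (\int[P]_w (X (p n) w ^+ l)) * ((\int[P]_w (X (r n) w ^+ l)) * (\int[P]_w W w)).
  move=> vp vr Jp Jr aW MW.
  under eq_Rintegral do rewrite exprMn -mulrA.
  rewrite (@Rintegral_rest _ _ _ P I X indX (J `|` [set r n]) (p n) (fun x => x ^+ l)
            (fun w => X (r n) w ^+ l * W w)).
  - congr (_ * _).
    by apply: (@Rintegral_rest _ _ _ P I X indX J (r n) (fun x => x ^+ l) W) => //;
      exact: has_momentsX.
  - by move=> [//|/= pr]; move: vr; rewrite -pr vp.
  - exact: exprn_measurable.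
  - apply: measurable_funM.
      by apply: measurable_funX; apply: adapted_coord; right.
    by apply: adapted_sub aW; left.
  - exact: has_momentsX.
  - by apply: has_momentsM => //; exact: has_momentsX.
apply: (@bernstein_even_moments _ _ _ P k q Y 24) => //.
- move=> n l m nk.
  pose J : set I := [set i |
    exists2 j, ((j < n)%N /\ v (p j) && ~~ v (r j)) & i = p j \/ i = r j].
  set W := fun w => (\sum_(j < n) Y j w) ^+ m.
  have MW : has_moments P W by apply/has_momentsX/has_moments_sum.
  have aW : adapted X J W.
    apply: measurable_funX; apply: (@adapted_sum _ _ _ P I X J n Y) => j jn.
    have [vj|/Yf ->] := boolP (v (p j) && ~~ v (r j)); last exact: measurable_cst.
    rewrite (Yt _ vj).
    by apply: measurable_funM; apply: adapted_coord; exists j; rewrite ?vj; auto.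
  have [vn|/Yf ->] := boolP (v (p n) && ~~ v (r n)); last first.
    rewrite RintegralZl// ?Rintegral_prob_cst//; exact: has_moments_integrable MW.
  rewrite (Yt _ vn); have /andP[vp vr] := vn.
  have ltnk j : (j < n)%N -> (j < k)%N by move=> jn; exact: ltn_trans jn nk.
  have Jp : ~ J (p n).
    move=> [j [jn /andP[vpj vrj]] [/injp e|e]].
      by have := e nk (ltnk _ jn) => e'; rewrite e' ltnn in jn.
    by move: vrj; rewrite -e vp.
  have Jr : ~ J (r n).
    move=> [j [jn /andP[vpj vrj]] [e|/injr e]].
      by move: vr; rewrite e vpj.
    by have := e nk (ltnk _ jn) => e'; rewrite e' ltnn in jn.
  rewrite (split2 n l W J)// mulrA; congr (_ * _).
  have := split2 n l (fun=> 1) set0 vp vr id id (measurable_cst _) M1.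
  under eq_Rintegral do rewrite mulr1.
  by move=> ->; rewrite Rintegral_prob_cst mulr1.
- move=> n nk; have [vn|/Yf ->] := boolP (v (p n) && ~~ v (r n)); last by rewrite Rintegral_prob_cst.
  rewrite (Yt _ vn); have /andP[vp vr] := vn.
  have := split2 n 1%N (fun=> 1) set0 vp vr id id (measurable_cst _) M1.
  under eq_Rintegral do rewrite mulr1 expr1.
  move=> ->; under eq_Rintegral do rewrite expr1.
  by have [_ -> _ _] := unitX (p n); rewrite mul0r.
- move=> n l nk; have [vn|/Yf ->] := boolP (v (p n) && ~~ v (r n)); last first.
    rewrite Rintegral_prob_cst; case: l => [|l]; first by rewrite !expr0 normr1 mulr1 fact0.
    by rewrite expr0n normr0 mulr_ge0// exprn_ge0.
  rewrite (Yt _ vn); have /andP[vp vr] := vn.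
  have := split2 n l (fun=> 1) set0 vp vr id id (measurable_cst _) M1.
  under eq_Rintegral do rewrite mulr1.
  move=> ->; rewrite Rintegral_prob_cst mulr1.
  have := sqr_moment_le (p n) l; have := sqr_moment_le (r n) l.
  set x := Rintegral _ _ _; set y := Rintegral _ _ _; set B := _ * _ => hy hx.
  rewrite ler_norml; apply/andP; split; nra.
Qed.

Lemma autocorrelation_moment (k q : nat) (p r : nat -> I) : (0 < q <= k)%N ->
  (forall i j, (i < k)%N -> (j < k)%N -> p i = p j -> i = j) ->
  (forall i j, (i < k)%N -> (j < k)%N -> r i = r j -> i = j) ->
  (forall j, (j < k)%N -> p j != r j) ->
  \int[P]_w ((\sum_(j < k) X (p j) w * X (r j) w) ^+ (2 * q))
    <= (16 * (64 * 24 ^+ 2) * q%:R * k%:R) ^+ q.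
Proof.
move=> qk injp injr pr; have q0 : (0 < q)%N by case/andP: qk.
have MS v : has_moments P (fun w => (\sum_(j < k | v (p j) && ~~ v (r j))
    X (p j) w * X (r j) w) ^+ (2 * q)).
  by apply/has_momentsX/has_moments_sum => j _; exact: has_momentsM.
pose F w (v : {ffun I -> bool}) := (\sum_(j < k | v (p j) && ~~ v (r j))
    X (p j) w * X (r j) w) ^+ (2 * q).
apply: (@le_trans _ _ (\int[P]_w (16 ^+ q * cube_mean (F w)))).
  apply: le_Rintegral => //.
  - apply: has_moments_integrable; apply/has_momentsX/has_moments_sum => j _.
    exact: has_momentsM.
  - apply: integrableZ_fun; apply: integrableZ_fun; apply: integrable_sum_fun => v _.
    exact: has_moments_integrable (MS v).
  (* No term has p j = r j, so decoupling reaches the whole sum. *)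
  - move=> w _; rewrite (eq_bigl (fun j : 'I_k => p j != r j)); last first.
      by move=> j; rewrite pr.
    exact: (@decouple_power R I _ (fun j : 'I_k => p j) (fun j : 'I_k => r j)).
rewrite RintegralZl//; last first.
  apply: integrableZ_fun; apply: integrable_sum_fun => v _.
  exact: has_moments_integrable (MS v).
rewrite -!(mulrA 16) [leRHS]exprMn ler_wpM2l ?exprn_ge0//.
rewrite RintegralZl//; last first.
  by apply: integrable_sum_fun => v _; exact: has_moments_integrable (MS v).
rewrite Rintegral_sum => [|v]; last exact: has_moments_integrable (MS v).
rewrite -[leRHS](@cube_mean_cst R I); apply: le_cube_mean => v.
exact: matching_sum_moment.
Qed.

End IndependentUnitVariates.

(** * Partial circulant matrices *)

Section Decomposition.
Variables (R : realType) (d : nat).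
Implicit Types (a kappa : 'I_d -> R) (y : 'cV[R]_d) (s : {ffun 'I_d -> bool}).

Definition diagonal_part k a y : R :=
  \sum_i y i ord0 ^+ 2 * \sum_(j < k) (a (sub_mod i j) ^+ 2 - 1).

Definition autocorrelation k a (x : 'I_d * 'I_d) : R :=
  \sum_(j < k) a (sub_mod x.1 j) * a (sub_mod x.2 j).

Definition off_diagonal_part k a y s : R :=
  \sum_(x : 'I_d * 'I_d | x.1 != x.2)
    y x.1 ord0 * y x.2 ord0 * autocorrelation k a x * (rsign (s x.1) * rsign (s x.2)).

Lemma enorm_sqr m (v : 'cV[R]_m) : enorm v ^+ 2 = \sum_i v i ord0 ^+ 2.
Proof. by rewrite sqr_sqrtr// sumr_ge0// => i _; exact: sqr_ge0. Qed.

Lemma circulant_mapB k a kappa y z :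
  circulant_map k a kappa y - circulant_map k a kappa z = circulant_map k a kappa (y - z).
Proof. by rewrite /circulant_map -scalerBr -mulmxBr. Qed.

Lemma enorm_circulant_map k a kappa y : (0 < k)%N ->
  k%:R * enorm (circulant_map k a kappa y) ^+ 2 =
  \sum_(j < k) (\sum_i a (sub_mod i j) * kappa i * y i ord0) ^+ 2.
Proof.
move=> k0; have kR : 0 < k%:R :> R by rewrite ltr0n.
rewrite enorm_sqr mulr_sumr; apply: eq_bigr => j _.
rewrite /circulant_map mxE exprMn exprVn sqr_sqrtr// mulVKf ?gt_eqF//.
congr (_ ^+ 2); rewrite mxE; apply: eq_bigr => i _; congr (_ * _).
rewrite mul_mx_diag !mxE//.
Qed.

Lemma circulant_decomposition k a y s : (0 < k)%N ->
  k%:R * enorm (circulant_map k a (fun i => rsign (s i)) y) ^+ 2 - k%:R * enorm y ^+ 2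
  = diagonal_part k a y + off_diagonal_part k a y s.
Proof.
move=> k0; rewrite enorm_circulant_map// enorm_sqr.
pose t (j : 'I_k) (x : 'I_d * 'I_d) :=
  a (sub_mod x.1 j) * a (sub_mod x.2 j) * (rsign (s x.1) * rsign (s x.2)) *
  (y x.1 ord0 * y x.2 ord0).
have -> : \sum_(j < k) (\sum_i a (sub_mod i j) * rsign (s i) * y i ord0) ^+ 2 =
    \sum_(x : 'I_d * 'I_d) \sum_(j < k) t j x.
  rewrite [RHS]exchange_big; apply: eq_bigr => j _.
  rewrite expr2 big_distrlr pair_bigA /=; apply: eq_bigr => x _; rewrite /t; ring.
rewrite (bigID (fun x : 'I_d * 'I_d => x.1 == x.2)) /= addrAC; congr (_ + _).
  rewrite (reindex_onto (fun i : 'I_d => (i, i)) fst) /=; last first.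
    by move=> [i j] /= /eqP ->.
  rewrite (eq_bigl xpredT) => [|i]; last by rewrite !eqxx.
  rewrite mulr_sumr -sumrB; apply: eq_bigr => i _.
  rewrite sumrB sumr_const card_ord mulrBr; congr (_ - _); last by rewrite mulrC.
  rewrite mulr_sumr; apply: eq_bigr => j _; rewrite /t /=.
  by rewrite -[rsign _ * _]expr2 rsign_sqr mulr1 mulrC -!expr2.
apply: eq_bigr => x _; rewrite /autocorrelation mulr_sumr mulr_suml.
by apply: eq_bigr => j _; rewrite /t; ring.
Qed.

Lemma distortion k (a : 'I_d -> R) y s (eps : R) : (0 < k)%N ->
  `|diagonal_part k a y| <= eps / 2 * (k%:R * enorm y ^+ 2) ->
  `|off_diagonal_part k a y s| <= eps / 2 * (k%:R * enorm y ^+ 2) ->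
  (1 - eps) * enorm y ^+ 2 <= enorm (circulant_map k a (fun i => rsign (s i)) y) ^+ 2
    <= (1 + eps) * enorm y ^+ 2.
Proof.
move=> k0; rewrite !ler_norml => /andP[D1 D2] /andP[h1 h2].
have kR : 0 < k%:R :> R by rewrite ltr0n.
have := circulant_decomposition a y s k0.
move: (enorm _) D1 D2 h1 h2 => u D1 D2 h1 h2; move: (enorm _) => v e.
by apply/andP; split; rewrite -(ler_pM2l kR); lra.
Qed.

(** Within a column the entries are distinct coordinates of a; this supplies the injectivity asked
    for in the moment bounds. *)
Lemma sub_mod_inj (i : 'I_d) j1 j2 : (j1 < d)%N -> (j2 < d)%N ->
  sub_mod i j1 = sub_mod i j2 -> j1 = j2.
Proof.
move=> j1d j2d /(congr1 val) /= /eqP; rewrite eqn_modDl => /eqP.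
wlog le12 : j1 j2 j1d j2d / (j1 <= j2)%N.
  by move=> H h; case/orP: (leq_total j1 j2) => le12;
    [exact: H h|symmetry; apply: H => //; exact: esym].
(* [d - j] is already a reduced residue unless j = 0, where it equals d and reduces to 0. *)
case: j1 => [|j1] in j1d le12 *; last first.
  case: j2 => // j2 in j2d le12 *; rewrite !modn_small; last 2 first.
  - by rewrite ltn_subrL (leq_ltn_trans _ j2d).
  - by rewrite ltn_subrL (leq_ltn_trans _ j1d).
  by move=> e; rewrite -(subKn (ltnW j1d)) e subKn// ltnW.
rewrite subn0 modnn; case: j2 => // j2 in j2d le12 *.
rewrite modn_small; last by rewrite ltn_subrL (leq_ltn_trans _ j2d).
by move=> /esym/eqP; rewrite subn_eq0 leqNgt j2d.
Qed.

Lemma sub_mod_neq (i1 i2 : 'I_d) j : i1 != i2 -> sub_mod i1 j != sub_mod i2 j.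
Proof.
apply: contra_neq => /(congr1 val) /= /eqP; rewrite eqn_modDr => /eqP.
by rewrite !modn_small// => /val_inj.
Qed.

End Decomposition.

Section CirculantMoments.
Context {disp : measure_display} {T : measurableType disp} {R : realType}.
Variable P : probability T R.
Variables (d : nat) (a : 'I_d -> {RV P >-> R}).
Hypothesis inda : mutually_independent a.
Hypothesis unita : forall i, unit_variate P (a i).
Variables (k q : nat).
Hypotheses (qk : (0 < q <= k)%N) (kd : (k <= d)%N).
Implicit Types y : 'cV[R]_d.

Let Ma i : has_moments P (a i). Proof. by case: (unita i). Qed.
Let q0 : (0 < q)%N. Proof. by case/andP: qk. Qed.
Let k0 : (0 < k)%N. Proof. by case/andP: qk => q0' /(leq_trans q0'). Qed.

Let sub_mod_injk (i : 'I_d) j1 j2 : (j1 < k)%N -> (j2 < k)%N ->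
  sub_mod i j1 = sub_mod i j2 -> j1 = j2.
Proof. by move=> h1 h2; apply: sub_mod_inj; exact: leq_trans kd. Qed.

Lemma has_moments_autocorrelation x :
  has_moments P (fun w => autocorrelation k (fun i => a i w) x).
Proof. by apply: has_moments_sum => j _; exact: has_momentsM. Qed.

Lemma has_moments_diagonal_part y :
  has_moments P (fun w => diagonal_part k (fun i => a i w) y).
Proof.
apply: has_moments_sum => i _; apply: has_momentsZ; apply: has_moments_sum => j _.
exact: has_moments_square_deviation.
Qed.

Lemma has_moments_off_diagonal_part y s :
  has_moments P (fun w => off_diagonal_part k (fun i => a i w) y s).
Proof.
apply: has_moments_sum => x _; apply: has_momentsM; last exact: has_moments_cst.
apply: has_momentsZ; exact: has_moments_autocorrelation.
Qed.

(** The column sums share coordinates of a, but convexity with weights y_i^2 reduces to one column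
    at a time, where the coordinates are distinct. *)
Lemma diagonal_part_moment y :
  \int[P]_w (diagonal_part k (fun i => a i w) y ^+ (2 * q)) <=
  (64 * 24 ^+ 2 * q%:R * k%:R) ^+ q * (enorm y ^+ 2) ^+ (2 * q).
Proof.
rewrite enorm_sqr; set S := \sum_i y i ord0 ^+ 2; set B := (_ * _) ^+ q.
have S0 : 0 <= S by apply: sumr_ge0 => i _; exact: sqr_ge0.
pose H i w := \sum_(j < k) (a (sub_mod i j) w ^+ 2 - 1).
have MH i : has_moments P (H i).
  by apply: has_moments_sum => j _; exact: has_moments_square_deviation.
apply: (@le_trans _ _ (\int[P]_w (S ^+ (2 * q).-1 *
    \sum_i y i ord0 ^+ 2 * H i w ^+ (2 * q)))).
  apply: le_Rintegral => //.
  - exact: has_moments_integrable (has_momentsX (2 * q) (has_moments_diagonal_part y)).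
  - apply: integrableZ_fun; apply: integrable_sum_fun => i _; apply: integrableZ_fun.
    exact: has_moments_integrable (has_momentsX (2 * q) (MH i)).
  - by move=> w _; apply: power_mean_even => // i; exact: sqr_ge0.
rewrite RintegralZl//; last first.
  apply: integrable_sum_fun => i _; apply: integrableZ_fun.
  exact: has_moments_integrable (has_momentsX (2 * q) (MH i)).
rewrite Rintegral_sum => [|i]; last first.
  apply: integrableZ_fun; exact: has_moments_integrable (has_momentsX (2 * q) (MH i)).
have -> : B * S ^+ (2 * q) = S ^+ (2 * q).-1 * \sum_i y i ord0 ^+ 2 * B.
  by rewrite -mulr_suml -/S mulrA -exprSr prednK ?muln_gt0// mulrC.
rewrite ler_wpM2l ?exprn_ge0//; apply: ler_sum => i _.
rewrite RintegralZl//; last exact: has_moments_integrable (has_momentsX (2 * q) (MH i)).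
rewrite ler_wpM2l ?sqr_ge0//.
apply: (@square_sum_moment _ _ _ P _ a inda unita k q (fun j => sub_mod i j)) => // j1 j2.
exact: sub_mod_injk.
Qed.

(** At fixed a the average over signs is bounded by [chaos]; convexity with weights [b] then
    isolates single autocorrelations. The weights vanish for equal indices, where
    [autocorrelation_moment] does not apply, and their total is at most |y|^4. *)
Lemma off_diagonal_part_moment y :
  cube_mean (fun s => \int[P]_w (off_diagonal_part k (fun i => a i w) y s ^+ (2 * q))) <=
  (16 * 128 ^+ 2 * (16 * (64 * 24 ^+ 2)) * q%:R ^+ 3 * k%:R * (enorm y ^+ 2) ^+ 2) ^+ q.
Proof.
rewrite enorm_sqr; set S := \sum_i y i ord0 ^+ 2.
have S0 : 0 <= S by apply: sumr_ge0 => i _; exact: sqr_ge0.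
pose G x w := autocorrelation k (fun i => a i w) x.
pose b x : R := if x.1 != x.2 then (y x.1 ord0 * y x.2 ord0) ^+ 2 else 0.
have b0 x : 0 <= b x by rewrite /b; case: ifP => // _; exact: sqr_ge0.
set W := \sum_x b x.
have W0 : 0 <= W by exact: sumr_ge0.
have WS : W <= S ^+ 2.
  rewrite expr2 /S big_distrlr pair_bigA; apply: ler_sum => x _ /=.
  by rewrite /b exprMn; case: ifP => // _; rewrite mulr_ge0 ?sqr_ge0.
have MO s := has_momentsX (2 * q) (has_moments_off_diagonal_part y s).
have MG x := has_momentsX (2 * q) (has_moments_autocorrelation x).
set K : R := 16 * (128 * q%:R) ^+ 2.
have K0 : 0 <= K by rewrite mulr_ge0 ?sqr_ge0.
have -> : cube_mean (fun s => \int[P]_w (off_diagonal_part k (fun i => a i w) y s ^+ (2 * q)))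
    = \int[P]_w cube_mean (fun s => off_diagonal_part k (fun i => a i w) y s ^+ (2 * q)).
  rewrite [RHS]RintegralZl//; last first.
    by apply: integrable_sum_fun => s _; exact: has_moments_integrable (MO s).
  by rewrite Rintegral_sum// => s; exact: has_moments_integrable (MO s).
apply: (@le_trans _ _ (\int[P]_w (K ^+ q * (W ^+ q.-1 * \sum_x b x * G x w ^+ (2 * q))))).
  apply: le_Rintegral => //.
  - apply: integrableZ_fun; apply: integrable_sum_fun => s _.
    exact: has_moments_integrable (MO s).
  - apply: integrableZ_fun; apply: integrableZ_fun; apply: integrable_sum_fun => x _.
    apply: integrableZ_fun; exact: has_moments_integrable (MG x).
  - move=> w _; apply: le_trans (chaos (fun i j => y i ord0 * y j ord0 * G (i, j) w) q0) _.
    rewrite -/K exprMn ler_wpM2l ?exprn_ge0//.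
    rewrite [X in X ^+ q](_ : _ = \sum_x b x * G x w ^+ 2); last first.
      rewrite big_mkcond; apply: eq_bigr => -[i j] _; rewrite /b /=.
      by case: ifP => _; rewrite ?mul0r// exprMn.
    have := @power_mean _ _ b (fun x => G x w ^+ 2) q.-1 b0 (fun x => sqr_ge0 _).
    rewrite prednK// => /le_trans; apply; rewrite ler_wpM2l ?exprn_ge0//.
    by apply: ler_sum => x _; rewrite exprM.
have iG x : P.-integrable setT (EFin \o (fun w => b x * G x w ^+ (2 * q))).
  by apply: integrableZ_fun; exact: has_moments_integrable (MG x).
have iGs : P.-integrable setT (EFin \o (fun w => \sum_x b x * G x w ^+ (2 * q))).
  exact: integrable_sum_fun.
rewrite RintegralZl//; last exact: integrableZ_fun.
rewrite RintegralZl// Rintegral_sum//.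
set B : R := 16 * (64 * 24 ^+ 2) * q%:R * k%:R.
have B0 : 0 <= B by rewrite !mulr_ge0.
apply: (@le_trans _ _ (K ^+ q * (W ^+ q.-1 * \sum_x b x * B ^+ q))).
  rewrite ler_wpM2l ?exprn_ge0// ler_wpM2l ?exprn_ge0//; apply: ler_sum => x _.
  rewrite RintegralZl//; last exact: has_moments_integrable (MG x).
  have [xx|xx] := eqVneq x.1 x.2; first by rewrite /b xx eqxx !mul0r.
  rewrite ler_wpM2l//.
  apply: (@autocorrelation_moment _ _ _ P _ a inda unita k q
    (fun j => sub_mod x.1 j) (fun j => sub_mod x.2 j)) => // [j1 j2|j1 j2|j _].
  - exact: sub_mod_injk.
  - exact: sub_mod_injk.
  - exact: sub_mod_neq.
rewrite -mulr_suml -/W [W ^+ _ * _]mulrA -exprSr prednK// -!exprMn.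
apply: lerXn2r; rewrite ?nnegrE ?mulr_ge0 ?sqr_ge0//.
have -> : 16 * 128 ^+ 2 * (16 * (64 * 24 ^+ 2)) * q%:R ^+ 3 * k%:R * S ^+ 2
  = K * (S ^+ 2 * B) by rewrite /K /B; ring.
by rewrite ler_wpM2l// ler_wpM2r.
Qed.

End CirculantMoments.

(** * From averages over the cube to the random signs *)

Section SignMixture.
Context {disp : measure_display} {T : measurableType disp} {R : realType}.
Variable P : probability T R.

Lemma probability_bigsetU_le (J : finType) (A : J -> set T) (p : J -> R) :
  (forall j, measurable (A j)) -> (forall j, (P (A j) <= (p j)%:E)%E) ->
  (P (\big[setU/set0]_j A j) <= (\sum_j p j)%:E)%E.
Proof.
move=> mA Ap; rewrite -sumEFin.
elim: (index_enum J) => [|j r IH]; first by rewrite !big_nil measure0.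
rewrite !big_cons; apply: le_trans (leeD (Ap j) IH).
by apply: measureU2 => //; exact: bigsetU_measurable.
Qed.

Variables (d : nat) (a kappa : 'I_d -> {RV P >-> R}).
Hypothesis ind_kappa : mutually_independent kappa.
Hypothesis sign_kappa : forall i, sign_bernoulli (kappa i).
Hypothesis ind_a_kappa : independent_families a kappa.

Definition sign_event (s : {ffun 'I_d -> bool}) : set T :=
  \big[setI/setT]_i (kappa i @^-1` [set rsign (s i)]).

Lemma sign_event_generated s : generated_sigma kappa (sign_event s).
Proof.
pose G := cylinder_generators kappa setT.
suff : G.-sigma.-measurable (sign_event s) by [].
apply: bigsetI_measurable => i _; apply: sub_sigma_algebra.
exists i => //; exists [set rsign (s i)]; first exact: measurable_set1.
by rewrite setTI.
Qed.

Lemma measurable_sign_event s : measurable (sign_event s).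
Proof. exact: measurable_generated (sign_event_generated s). Qed.

Lemma probability_sign_event s : P (sign_event s) = ((2 ^+ #|'I_d|)^-1)%:E.
Proof.
have allI : (fun i : 'I_d => i \in [set: 'I_d]%SET) =1 xpredT by move=> i; rewrite inE.
have := @ind_kappa [set: 'I_d]%SET (fun i => [set rsign (s i)]) (fun i _ => measurable_set1 _).
rewrite (eq_bigl _ _ allI) (eq_bigl _ _ allI) => ->.
rewrite (eq_bigr (fun=> (2^-1)%:E)) => [|i _].
  by rewrite prodEFin prodr_const exprVn.
have [k1 kN1] := sign_kappa i; rewrite /rsign; case: (s i); first by rewrite expr1.
by rewrite expr0.
Qed.

(** On [sign_event s] the signs are the constants [s]. This event has probability 2^-d and is
    independent of [a], so the Markov bounds add up to a cube average of moments, without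
    conditional expectations. *)
Lemma sign_mixture (F : {ffun 'I_d -> bool} -> T -> R) t q : 0 < t ->
  (forall s, has_moments P (F s)) -> (forall s, adapted a setT (F s)) ->
  (P (\big[setU/set0]_s ([set w | (t < `|F s w|)%R] `&` sign_event s)) <=
   (cube_mean (fun s => \int[P]_w (F s w ^+ (2 * q))) / t ^+ (2 * q))%:E)%E.
Proof.
move=> t0 MF aF; rewrite /cube_mean mulr_sumr mulr_suml.
apply: probability_bigsetU_le => s.
  apply: measurableI; last exact: measurable_sign_event.
  exact: measurable_norm_gt (has_moments_measurable (MF s)).
rewrite ind_a_kappa; last exact: sign_event_generated.
  rewrite probability_sign_event muleC -mulrA EFinM.
  rewrite lee_pmul2l ?lte_fin ?invr_gt0 ?exprn_gt0//.
  exact: markov_moment.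
pose G := cylinder_generators a setT.
suff : G.-sigma.-measurable [set w | (t < `|F s w|)%R] by [].
exact: (@measurable_norm_gt _ (g_sigma_algebraType G) R (F s) t (aF s)).
Qed.

End SignMixture.

(** * Choice of the moment order and the union bound *)

Section Tail.
Variable R : realType.

(** The integer part of ln n, plus 3, lies between ln n + 2 and ln n + 3; as ln n >= 1/2 for n >= 2,
    the latter is at most 7 ln n. *)
Lemma moment_order (n : nat) : (1 < n)%N ->
  exists2 q : nat, (0 < q)%N & ln (n%:R : R) + 2 <= q%:R <= 7 * ln (n%:R : R).
Proof.
move=> n1.
have ln2 : 2^-1 <= ln (n%:R : R).
  rewrite -[leLHS]expRK ler_ln ?posrE ?expR_gt0 ?ltr0n ?(ltn_trans _ n1)//.
  by apply: le_trans (expR_half_le2 R) _; rewrite ler_nat.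
exists (Num.truncn (ln (n%:R : R))).+3 => //.
have l0 : 0 <= ln (n%:R : R) by lra.
have /andP[h1 h2] := truncn_itv l0.
rewrite -addn3 natrD; rewrite -addn1 natrD in h2.
by apply/andP; split; lra.
Qed.

(** The ratio is the q-th power of 4K q^3 / (eps^2 k), and 64 = 16 * 4 puts the base below 1/16. *)
Lemma tail_ratio (K eps S : R) (q k : nat) : 0 < K -> 0 < eps -> 0 < S ->
  (0 < k)%N -> 64 * K * q%:R ^+ 3 / eps ^+ 2 <= k%:R ->
  (K * q%:R ^+ 3 * k%:R * S ^+ 2) ^+ q / (eps / 2 * (k%:R * S)) ^+ (2 * q)
    <= (16 ^+ q)^-1.
Proof.
move=> K0 e0 S0 k0 hk; have kR : 0 < k%:R :> R by rewrite ltr0n.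
have e2 : 0 < eps ^+ 2 by rewrite exprn_gt0.
rewrite exprM -expr_div_n -exprVn.
have -> : K * q%:R ^+ 3 * k%:R * S ^+ 2 / (eps / 2 * (k%:R * S)) ^+ 2
  = (4 * K * q%:R ^+ 3 / eps ^+ 2) / k%:R by field; rewrite !gt_eqF.
have h0 : 0 <= 4 * K * q%:R ^+ 3 / eps ^+ 2.
  by rewrite divr_ge0 ?(ltW e2)// !mulr_ge0// ltW.
have h1 : 0 <= 4 * K * q%:R ^+ 3 / eps ^+ 2 / k%:R by rewrite divr_ge0.
apply: lerXn2r; rewrite ?nnegrE ?invr_ge0//.
rewrite ler_pdivrMr//.
have : 64 * K * q%:R ^+ 3 / eps ^+ 2 = 16 * (4 * K * q%:R ^+ 3 / eps ^+ 2).
  by field; rewrite gt_eqF.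
by move: hk h0; set u := 4 * K * _ / _; set v := 64 * K * _ / _; lra.
Qed.

(** 4^q >= e^(ln n + 2) >= 3n, so the left side is at most 2/9. *)
Lemma union_bound_le (n q : nat) : (0 < n)%N -> ln (n%:R : R) + 2 <= q%:R ->
  (n * n)%:R * (2 * (16 ^+ q)^-1) <= 3^-1 :> R.
Proof.
move=> n0 hq; have nR : 0 < n%:R :> R by rewrite ltr0n.
have h4 : expR (ln (n%:R : R) + 2) <= 4 ^+ q.
  apply: (@le_trans _ _ (expR (1 * q%:R))); first by rewrite ler_expR mul1r.
  by rewrite expRM_natr lerXn2r ?nnegrE ?expR_ge0 ?expR1_le4.
rewrite expRD lnK ?posrE// in h4.
have e3 : 3 <= expR 2 :> R by apply: le_trans (expR_ge1Dx _); lra.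
have h : n%:R * 3 <= 4 ^+ q :> R by apply: le_trans h4; rewrite ler_pM2l.
have -> : 16 ^+ q = (4 ^+ q) ^+ 2 :> R.
  by rewrite -exprM mulnC exprM; congr (_ ^+ _); lra.
have p0 : 0 < 4 ^+ q :> R by rewrite exprn_gt0.
rewrite natrM mulrA ler_pdivrMr ?exprn_gt0//; nra.
Qed.

End Tail.

Section PairBound.
Context {disp : measure_display} {T : measurableType disp} {R : realType}.
Variable P : probability T R.
Variables (d : nat) (a kappa : 'I_d -> {RV P >-> R}).
Hypothesis ind_a : mutually_independent a.
Hypothesis unit_a : forall i, unit_variate P (a i).
Hypothesis ind_kappa : mutually_independent kappa.
Hypothesis sign_kappa : forall i, sign_bernoulli (kappa i).
Hypothesis ind_a_kappa : independent_families a kappa.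

(** Only the off-diagonal part involves the signs; there [s] is the pattern that kappa actually
    takes. *)
Definition bad_event k eps (y : 'cV[R]_d) : set T :=
  let t := eps / 2 * (k%:R * enorm y ^+ 2) in
  [set w | (t < `|diagonal_part k (fun i => a i w) y|)%R] `|`
  \big[setU/set0]_(s : {ffun 'I_d -> bool})
     ([set w | (t < `|off_diagonal_part k (fun i => a i w) y s|)%R] `&` sign_event kappa s).

Lemma adapted_off_diagonal_part k y s :
  adapted a setT (fun w => off_diagonal_part k (fun i => a i w) y s).
Proof.
rewrite /adapted /off_diagonal_part; under eq_fun do rewrite big_mkcond.
apply: measurable_sum => x; case: (x.1 != x.2) => //.
apply: measurable_funM => //; apply: measurable_funM => //.
by apply: measurable_sum => j; apply: measurable_funM; apply: adapted_coord.
Qed.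

Lemma measurable_bad_event k eps y : measurable (bad_event k eps y).
Proof.
apply: measurableU.
  by apply: measurable_norm_gt; case: (has_moments_diagonal_part unit_a k y).
apply: bigsetU_measurable => s _; apply: measurableI; last exact: measurable_sign_event.
by apply: measurable_norm_gt; case: (has_moments_off_diagonal_part unit_a k y s).
Qed.

Lemma bad_event_bound k q eps (y : 'cV[R]_d) : (0 < q <= k)%N -> (k <= d)%N -> 0 < eps ->
  0 < enorm y ^+ 2 ->
  64 * (16 * 128 ^+ 2 * (16 * (64 * 24 ^+ 2))) * q%:R ^+ 3 / eps ^+ 2 <= k%:R ->
  (P (bad_event k eps y) <= (2 * (16 ^+ q)^-1)%:E)%E.
Proof.
move=> qk kd e0 S0; set K : R := 16 * 128 ^+ 2 * _ => hk.
have K0 : 0 < K by rewrite /K; lra.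
have /andP[q0 qlek] := qk; have k0 : (0 < k)%N by exact: leq_trans qlek.
set S := enorm y ^+ 2 in S0 *.
have t0 : 0 < eps / 2 * (k%:R * S).
  by apply: mulr_gt0; [exact: divr_gt0|apply: mulr_gt0; rewrite ?ltr0n].
have tail := tail_ratio K0 e0 S0 k0 hk.
have tinv : 0 <= ((eps / 2 * (k%:R * S)) ^+ (2 * q))^-1 by rewrite invr_ge0 exprn_ge0 ?ltW.
have Md := has_moments_diagonal_part unit_a k y.
have Mo s := has_moments_off_diagonal_part unit_a k y s.
have m1 : measurable [set w |
    (eps / 2 * (k%:R * S) < `|diagonal_part k (fun i => a i w) y|)%R].
  by apply: measurable_norm_gt; case: Md.
have m2 : measurable (\big[setU/set0]_(s : {ffun 'I_d -> bool})
     ([set w | (eps / 2 * (k%:R * S) < `|off_diagonal_part k (fun i => a i w) y s|)%R]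
      `&` sign_event kappa s)).
  apply: bigsetU_measurable => s _; apply: measurableI; last exact: measurable_sign_event.
  by apply: measurable_norm_gt; case: (Mo s).
apply: le_trans (measureU2 _ m1 m2) _.
have -> : 2 * (16 ^+ q)^-1 = (16 ^+ q)^-1 + (16 ^+ q)^-1 :> R by ring.
rewrite EFinD; apply: leeD.
  apply: le_trans (markov_moment q Md t0) _; rewrite lee_fin.
  apply: le_trans tail; rewrite ler_wpM2r//.
  apply: le_trans (diagonal_part_moment ind_a unit_a qk kd y) _.
  rewrite -/S exprM -exprMn.
  have A0 : 0 <= 64 * 24 ^+ 2 * q%:R * k%:R * S ^+ 2.
    apply: mulr_ge0; last exact: sqr_ge0.
    by apply: mulr_ge0 => //; apply: mulr_ge0 => //; lra.
  (* Since q >= 1, the smaller diagonal bound is absorbed into the off-diagonal one, and a single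
     tail estimate serves both. *)
  have AB : 64 * 24 ^+ 2 * q%:R * k%:R * S ^+ 2 <= K * q%:R ^+ 3 * k%:R * S ^+ 2.
    rewrite ler_wpM2r ?sqr_ge0// ler_wpM2r//.
    apply: ler_pM => //; first by rewrite /K; lra.
    have : 1 <= q%:R :> R by rewrite ler1n.
    by move=> q1; rewrite exprS ler_peMr// exprn_ege1.
  by apply: lerXn2r => //; rewrite nnegrE; exact: le_trans AB.
apply: le_trans (sign_mixture ind_kappa sign_kappa ind_a_kappa q t0 Mo _) _.
  by move=> s; exact: adapted_off_diagonal_part.
rewrite lee_fin; apply: le_trans tail; rewrite ler_wpM2r//.
exact: off_diagonal_part_moment.
Qed.

End PairBound.

(** For coincident points the Markov threshold would be 0, so they are treated deterministically. *)
Lemma distortion0 (R : realType) k d (a kappa : 'I_d -> R) (y : 'cV[R]_d) (eps : R) :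
  enorm y ^+ 2 = 0 ->
  (1 - eps) * enorm y ^+ 2 <= enorm (circulant_map k a kappa y) ^+ 2
    <= (1 + eps) * enorm y ^+ 2.
Proof.
move=> y0; suff -> : y = 0.
  by rewrite /circulant_map mulmx0 scaler0 !enorm_sqr !big1 ?mulr0 ?lexx// => i _;
    rewrite mxE expr0n.
apply/colP => i; apply/eqP; rewrite mxE -sqrf_eq0; move/eqP: y0; rewrite enorm_sqr.
by rewrite psumr_eq0 => [/allP/(_ i)|j _]; [apply; rewrite mem_index_enum|exact: sqr_ge0].
Qed.

Lemma rsign_of_pm1 (R : realType) (x : R) : x = 1 \/ x = -1 -> rsign (x == -1) = x.
Proof.
by case=> ->; rewrite /rsign ?eqxx ?expr1// gt_eqF ?expr0//; lra.
Qed.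

Theorem theorem2p1 (R : realType) :
  exists C : R, 0 < C /\
  forall (n d : nat) (x : 'I_n -> 'cV[R]_d) (eps : R) (k : nat),
    (1 <= n)%N -> (1 <= d)%N ->
    0 < eps -> eps < 2^-1 ->
    (1 <= k)%N -> (k <= d)%N ->
    C * eps ^- 2 * ln (n%:R : R) ^+ 3 <= k%:R ->
  forall (disp : measure_display) (T : measurableType disp)
    (P : probability T R) (a kappa : 'I_d -> {RV P >-> R}),
    mutually_independent a ->
    ((forall i, sign_bernoulli (a i)) \/ (forall i, standard_normal (a i))) ->
    mutually_independent kappa ->
    (forall i, sign_bernoulli (kappa i)) ->
    independent_families a kappa ->
    let f (w : T) := circulant_map k (fun i => a i w) (fun i => kappa i w) in
    ((2 / 3)%:E <=
      P [set w | (forall i j : 'I_n,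
           (1 - eps) * enorm (x i - x j) ^+ 2
             <= enorm (f w (x i) - f w (x j)) ^+ 2
             <= (1 + eps) * enorm (x i - x j) ^+ 2)%R])%E.
Proof.
pose K : R := 16 * 128 ^+ 2 * (16 * (64 * 24 ^+ 2)).
(* 64 K is the requirement of [tail_ratio], and 7^3 comes from q <= 7 ln n. *)
exists (64 * K * 7 ^+ 3); split; first by rewrite /K; lra.
move=> n d x eps k n0 d0 e0 e2 k0 kd hC disp T P a kappa ind_a law_a ind_kappa sign_kappa
  ind_ak.
pose f w := circulant_map k (fun i => a i w) (fun i => kappa i w).
have unit_a i : unit_variate P (a i).
  by case: law_a => law_a;
    [exact: sign_bernoulli_unit_variate|exact: standard_normal_unit_variate].
pose good (z : 'I_n * 'I_n) : set T := [set w |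
  ((1 - eps) * enorm (x z.1 - x z.2) ^+ 2 <=
    enorm (f w (x z.1 - x z.2)) ^+ 2 <= (1 + eps) * enorm (x z.1 - x z.2) ^+ 2)%R].
rewrite /= [X in (_ <= P X)%E](_ : _ = \big[setI/setT]_z good z); last first.
  apply/seteqP; split=> w /=; last first.
    by rewrite -bigcap_seq => h i j; rewrite circulant_mapB; exact: (h (i, j) (mem_index_enum _)).
  by move=> h; rewrite -bigcap_seq => -[i j] _; rewrite /good /= /f -circulant_mapB; exact: h.
(* For n = 1 the logarithm is 0 and admits no moment order, but the only pair is trivial. *)
have [n1|n1] := leqP n 1.
  have -> : \big[setI/setT]_z good z = setT.
    rewrite big1 // => -[i j] _; apply/seteqP; split=> // w _; apply: distortion0.
    have -> : i = j by apply: val_inj; case: i j => [[|i] ?] [[|j] ?] //=; lia.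
    by rewrite subrr enorm_sqr big1// => l _; rewrite mxE expr0n.
  by rewrite probability_setT lee_fin; lra.
have [q q0 /andP[q1 q2]] := moment_order R n1.
have eps2 : 0 < eps ^+ 2 by rewrite exprn_gt0.
have hk : 64 * K * q%:R ^+ 3 / eps ^+ 2 <= k%:R.
  apply: le_trans hC.
  have -> : 64 * K * 7 ^+ 3 * eps ^- 2 * ln (n%:R : R) ^+ 3 =
      64 * K * (7 * ln (n%:R : R)) ^+ 3 / eps ^+ 2 by ring.
  rewrite ler_wpM2r ?invr_ge0 ?(ltW eps2)// ler_wpM2l//; first by rewrite /K; lra.
  by rewrite lerXn2r ?nnegrE//; exact: le_trans q2.
have qk : (0 < q <= k)%N.
  rewrite q0 -(ler_nat R) /=; apply: le_trans hk.
  rewrite ler_pdivlMr//.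
  have qR : 1 <= q%:R :> R by rewrite ler1n.
  have q3 : q%:R <= q%:R ^+ 3 :> R by rewrite exprS ler_peMr// exprn_ege1.
  have K1 : 1 <= 64 * K by rewrite /K; lra.
  have e1 : eps ^+ 2 <= 1 by rewrite expr_le1// ?ltW//; lra.
  nra.
pose bad (z : 'I_n * 'I_n) : set T :=
  if enorm (x z.1 - x z.2) ^+ 2 == 0 then set0 else bad_event a kappa k eps (x z.1 - x z.2).
have mbad z : measurable (bad z).
  by rewrite /bad; case: ifP => _ //; exact: measurable_bad_event.
have pbad z : (P (bad z) <= (2 * (16 ^+ q)^-1)%:E)%E.
  rewrite /bad; case: ifPn => [_|z0].
    by rewrite measure0 lee_fin mulr_ge0// invr_ge0 exprn_ge0.
  by apply: bad_event_bound => //; rewrite lt_def z0 sqr_ge0.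
(* The random signs are 1 or -1 only almost surely; the exceptional null sets must be removed before
   a sign pattern can be read off. *)
pose nonsign i : set T := ~` (kappa i @^-1` [set 1] `|` kappa i @^-1` [set -1]).
have mk i r : measurable (kappa i @^-1` [set r]).
  by rewrite -[X in measurable X]setTI; exact: measurable_funP.
have mnon i : measurable (nonsign i) by apply: measurableC; exact: measurableU.
pose B := \big[setU/set0]_i nonsign i `|` \big[setU/set0]_z bad z.
have mB : measurable B by apply: measurableU; exact: bigsetU_measurable.
have PB : (P B <= (3^-1)%:E)%E.
  apply: le_trans (measureU2 _ _ _) _; try exact: bigsetU_measurable.
  have h1 : (P (\big[setU/set0]_i nonsign i) <= (\sum_(i < d) 0)%:E)%E.
    by apply: probability_bigsetU_le => // i; rewrite /nonsign sign_bernoulli_ae.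
  have h2 : (P (\big[setU/set0]_z bad z) <= (\sum_(z : 'I_n * 'I_n) 2 * (16 ^+ q)^-1)%:E)%E.
    exact: probability_bigsetU_le.
  apply: le_trans (leeD h1 h2) _; rewrite -EFinD lee_fin big1// add0r.
  by rewrite sumr_const card_prod card_ord -[leLHS]mulr_natl; exact: union_bound_le.
have mgood : measurable (\big[setI/setT]_z good z).
  apply: bigsetI_measurable => z _.
  pose c1 := (1 - eps) * enorm (x z.1 - x z.2) ^+ 2.
  pose c2 := (1 + eps) * enorm (x z.1 - x z.2) ^+ 2.
  pose g w := k%:R^-1 * \sum_(j < k)
    (\sum_i a (sub_mod i j) w * kappa i w * (x z.1 - x z.2) i ord0) ^+ 2.
  have gE w : enorm (f w (x z.1 - x z.2)) ^+ 2 = g w.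
    rewrite /g -(enorm_circulant_map (fun i => a i w) (fun i => kappa i w))//.
    by rewrite mulKf// pnatr_eq0 -lt0n.
  have -> : good z = g @^-1` `[c1, c2].
    by apply/seteqP; split=> w; rewrite /good /= in_itv /= gE.
  rewrite -[X in measurable X]setTI; apply: (_ : measurable_fun setT g) => //.
  apply: measurable_funM => //; apply: measurable_sum => j; apply: measurable_funX.
  by apply: measurable_sum => i; apply: measurable_funM => //; apply: measurable_funM.
apply: (@le_trans _ _ (P (~` B))).
  rewrite probability_setC//.
  have -> : 2 / 3 = 1 - 3^-1 :> R by lra.
  by rewrite EFinB leeB.
apply: le_measure; rewrite ?inE//; first exact: measurableC.
move=> w; rewrite /B setCU => -[/= w1 w2].
have kw i : rsign (kappa i w == -1) = kappa i w.
  apply: rsign_of_pm1; apply: contrapT => h; apply: w1.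
  by rewrite -bigcup_seq; exists i; [exact: mem_index_enum|].
rewrite -bigcap_seq => z _; rewrite /good /f /=.
have [z0|z0] := eqVneq (enorm (x z.1 - x z.2) ^+ 2) 0; first exact: distortion0.
have nb : ~ bad_event a kappa k eps (x z.1 - x z.2) w.
  move=> h; apply: w2; rewrite -bigcup_seq; exists z; first exact: mem_index_enum.
  by rewrite /= /bad (negPf z0).
(* The pattern realized at [w]: a failure of either half of the distortion bound would put [w] in
   [bad_event], the off-diagonal half through this [s]. *)
pose s := [ffun i => kappa i w == -1].
have -> : (fun i => kappa i w) = (fun i => rsign (s i)).
  by apply/funext => i; rewrite ffunE kw.
apply: distortion => //; rewrite leNgt; apply/negP => h; apply: nb; first by left.
right; rewrite -bigcup_seq; exists s; first exact: mem_index_enum.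
split=> //; rewrite /sign_event -bigcap_seq => i _ /=.
by rewrite ffunE kw.
Qed.
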